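(* Let $k\geq 1$. For any Young diagram $\lambda$ and any permutation $\tau$, the set-valued statistic $\mathrm{Peak}$ is equidistributed over $\mathcal{T}_{\lambda}(I_k\oplus\tau)$ and $\mathcal{T}_{\lambda}(J_k\oplus\tau)$, that is, $$\sum_{T \in \mathcal{T}_{\lambda}(I_k\oplus\tau)}t^{\mathrm{Peak}(T)} = \sum_{T \in \mathcal{T}_{\lambda}(J_k\oplus\tau)}t^{\mathrm{Peak}(T)}.$$
   Context: Young diagrams are identified with integer partitions and drawn left-justified; the square $(i,j)$ is the square in the $i$-th column (columns numbered left to right) and $j$-th row (rows numbered top to bottom). $c_j(\lambda)$ denotes the length of the $j$-th column of $\lambda$. A transversal $T$ of shape $\lambda$ is a $01$-filling of the squares of $\lambda$ such that each row and each column contains exactly one $1$. If $\lambda$ has $n$ columns, write $T=t_1t_2\cdots t_n$, where the $1$ in column $i$ is in the square $(i,t_i)$. $\mathcal{T}_\lambda$ is the set of transversals of shape $\lambda$. An index $i$ with $2\le i\le n-1$ and $c_{i-1}(\lambda)=c_i(\lambda)=c_{i+1}(\lambda)$ is a peak of $T$ if $t_{i-1}<t_i>t_{i+1}$. $\mathrm{Peak}(T)$ is the set of peaks of $T$. $T$ contains a pattern $\sigma\in\mathcal{S}_m$ (a permutation of $\{1,\dots,m\}$) if there are rows $r_1<\cdots<r_m$ and columns $c_1<\cdots<c_m$ such that every square $(c_i,r_j)$ lies in $\lambda$ and the restriction of $T$ to these rows and columns is the permutation matrix of $\sigma$ (i.e. the $1$'s are exactly in squares $(c_i,r_{\sigma_i})$).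 Otherwise $T$ avoids $\sigma$. $\mathcal{T}_\lambda(\sigma)$ is the set of $\sigma$-avoiding transversals of shape $\lambda$. $I_k=12\cdots k$ and $J_k=k\cdots 21$. For $\pi\in\mathcal{S}_a$ and $\sigma\in\mathcal{S}_b$, the direct sum is $\pi\oplus\sigma=\pi_1\cdots\pi_a(\sigma_1+a)\cdots(\sigma_b+a)$; for the empty permutation $\epsilon$, $\pi\oplus\epsilon=\pi$. For a finite set $A$ of positive integers, $t^A=\prod_{i\in A}t_i$ with $t_1,t_2,\ldots$ commuting indeterminates, and $t^{\emptyset}=1$. *)

(* Defs.v *)
From mathcomp Require Import all_boot all_fingroup.

Set Implicit Arguments.
Unset Strict Implicit.
Unset Printing Implicit Defensive.

(* Columns and rows are numbered from 0, so column i below is the (i+1)-st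
   column of the diagram, and a peak i below is the peak i+1 of the 1-based
   numbering.  Squares are written (column, row). *)

(* The parts of lam are the row lengths, from the top row down. *)
Definition is_partition (lam : seq nat) : bool := sorted geq lam && (0 \notin lam).

Definition nrows (lam : seq nat) : nat := size lam.
Definition ncols (lam : seq nat) : nat := head 0 lam.

Definition square (lam : seq nat) : finType :=
  ('I_(ncols lam) * 'I_(nrows lam))%type.

Definition diagram (lam : seq nat) : {set square lam} :=
  [set x : square lam | x.1 < nth 0 lam x.2].

Definition col_len (lam : seq nat) (i : nat) : nat := count (fun p => i < p) lam.

(* A 01-filling is represented by the set of the squares that contain a 1. *)
Definition transversals (lam : seq nat) : {set {set square lam}} :=
  [set T : {set square lam} |
    [&& T \subset diagram lam,
        [forall c : 'I_(ncols lam), #|[set x in T | x.1 == c]| == 1] &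
        [forall r : 'I_(nrows lam), #|[set x in T | x.2 == r]| == 1]]].

(* t_i: the row of the 1 in column i; the default value 0 is only used when
   column i of T is empty. *)
Definition row_of (lam : seq nat) (T : {set square lam}) (i : nat) : nat :=
  if [pick x in T | x.1 == i :> nat] is Some x then x.2 else 0.

Definition Peak (lam : seq nat) (T : {set square lam}) : {set 'I_(ncols lam)} :=
  [set i : 'I_(ncols lam) |
    [&& 0 < i, i.+1 < ncols lam,
        col_len lam i.-1 == col_len lam i,
        col_len lam i == col_len lam i.+1,
        row_of T i.-1 < row_of T i &
        row_of T i.+1 < row_of T i]].

Definition increasing (m n : nat) (f : {ffun 'I_m -> 'I_n}) : bool :=
  [forall i : 'I_m, forall j : 'I_m, (i < j) ==> (f i < f j)].

Definition contains (lam : seq nat) (m : nat) (T : {set square lam})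
    (s : 'S_m) : bool :=
  [exists c : {ffun 'I_m -> 'I_(ncols lam)},
   exists r : {ffun 'I_m -> 'I_(nrows lam)},
    [&& increasing c, increasing r,
        [forall i : 'I_m, forall j : 'I_m, (c i, r j) \in diagram lam] &
        [forall i : 'I_m, forall j : 'I_m, ((c i, r j) \in T) == (s i == j)]]].

Definition avoiders (lam : seq nat) (m : nat) (s : 'S_m) : {set {set square lam}} :=
  [set T in transversals lam | ~~ contains T s].

Definition perm_I (k : nat) : 'S_k := 1%g.
Definition perm_J (k : nat) : 'S_k := perm (@rev_ord_inj k).

Section DirectSum.
Variables (a b : nat) (p : 'S_a) (s : 'S_b).

Definition dsum_fun (i : 'I_(a + b)) : 'I_(a + b) :=
  match split i with
  | inl j => lshift b (p j)
  | inr j => rshift a (s j)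
  end.

Lemma dsum_fun_inj : injective dsum_fun.
Proof.
move=> x y; rewrite /dsum_fun -{2}(splitK x) -{2}(splitK y).
case: (split x) => i; case: (split y) => j /= /eqP.
- by rewrite eq_lshift => /eqP /perm_inj ->.
- by rewrite eq_lrshift.
- by rewrite eq_rlshift.
- by rewrite eq_rshift => /eqP /perm_inj ->.
Qed.

Definition dsum : 'S_(a + b) := perm dsum_fun_inj.

End DirectSum.

(* Main.v *)
Require Import Defs.
From mathcomp Require Import all_boot all_order all_fingroup all_algebra zify.
From mathcomp Require Import mpoly.
From Stdlib Require Import FunctionalExtensionality.

(** The part of the diagram in which [tau] can be completed is again a diagram, so only
increasing and decreasing chains have to be compared.  For these, Schensted insertion turns
transversals into walks of partitions, and transposing the partitions exchanges the two.

A transversal is read as the word of the rows of its 1s, column after column, together with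
the word of the column lengths.

Chains.  Follow the boundary of the diagram from its lower left to its upper right corner,
row-insert the letter of each column that is passed, and delete the largest letter at each
row that is passed.  The shapes form a walk of partitions from the empty one to itself, which
gains a box at each column and loses one at each row, and every such walk comes from exactly
one filling ([labelsK], [unlabels_walk]).  By Schensted's theorem a filling has an increasing
chain of length k exactly when some shape has a row of length at least k ([chain_ltnP]), and
a decreasing one exactly when some shape has at least k rows ([chain_gtnP]).  Transposing all the
shapes is therefore an involution [flip] that exchanges the two kinds of chains; it also
exchanges ascents and descents between neighbouring columns of equal length ([flip_asc]),
hence peaks and valleys.

From valleys back to peaks.  Cut the columns into blocks of equal length.  A word without an
interior peak decreases and then increases; it corresponds to the word without an interior
valley on the same letters that has, for all bounds lo and hi, equally long increasing
subsequences with letters between lo and hi ([covers_to_hill]).  Replacing the blocks this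
way, and then applying [flip], shows that for each cut the number of fillings whose blocks
have no interior peak is the same for both kinds of forbidden chain ([count_blocks]).

Enough cuts.  No two peaks are consecutive.  For a set K without consecutive elements there
is a cut whose blocks have as interior positions those of K and the single positions between
two elements of K, and K is the only subset of that set which has at least #|K| elements and
no two consecutive ones ([card_sparse_patch]).  By inclusion and exclusion and induction on
#|K|, the counts above determine the number of fillings with peak set K ([sparse_determined]).

General [tau].  A square is white if there is a copy of [tau] strictly to its right and
below it.  The white squares form a diagram, a filling avoids the direct sum of s and [tau]
exactly when its white part avoids s ([occurs_dsum], [white_chain]), and rearranging the
white part changes neither the white squares ([white_replace_white]) nor the comparison of
neighbouring columns of equal length unless both have a white 1 ([asc_white_gray],
[desc_gray_white]).  So an injection between the avoiders of chains that preserves peaks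
extends to one between the avoiders of the direct sums; as there is one in each direction,
both are bijections. *)

Set Implicit Arguments.
Unset Strict Implicit.
Unset Printing Implicit Defensive.

(** * Row insertion *)

(** A partial standard tableau, stored as the list of the row indices of its entries, largest
possible entry first: position j counted from the end is the entry j, and [None] means that
j does not occur.  Deleting the largest possible entry is then [behead]. *)
Notation tableau := (seq (option nat)).

(** Schensted row insertion in one scan from the small entries to the large ones.  The second
component is the row that received the last moved entry, whose next larger entry must leave
it; at the end of the scan it is the row of the new box. *)
Fixpoint insert (x : nat) (s : tableau) : tableau * option nat :=
  if s is a :: s1 then
    let: (s2, h) := insert x s1 in
    if size s1 == x then (Some 0 :: s2, Some 0) else
    if h is Some i then
      if a == Some i then (Some i.+1 :: s2, Some i.+1) else (a :: s2, h)
    else (a :: s2, None)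
  else ([::], None).

Fixpoint uninsert (i : nat) (s : tableau) : tableau * nat :=
  if s is a :: s1 then
    if a == Some i then
      if i is j.+1 then let: (s2, x) := uninsert j s1 in (Some j :: s2, x)
      else (None :: s1, size s1)
    else let: (s2, x) := uninsert i s1 in (a :: s2, x)
  else ([::], 0).

Fixpoint row_at (s : tableau) (r : nat) : option nat :=
  if s is a :: s1 then if r == size s1 then a else row_at s1 r else None.

Definition row_len (s : tableau) (i : nat) : nat := count_mem (Some i) s.
Arguments row_len : simpl never.

(** Each initial set of entries occupies a partition, which is what makes the rows a standard
tableau. *)
Fixpoint standard (s : tableau) : Prop :=
  if s is _ :: s1 then standard s1 /\ (forall i, row_len s i.+1 <= row_len s i) else True.

Lemma size_insert x s : size (insert x s).1 = size s.
Proof.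
elim: s => //= a s; case: (insert x s) => s2 h /= <-.
by case: ifP => // _; case: h => // i; case: ifP.
Qed.

Lemma insert_ge x s : size s <= x -> insert x s = (s, None).
Proof.
elim: s => //= a s IH sx; rewrite IH; last exact: ltnW.
by rewrite ltn_eqF.
Qed.

Lemma insert_some x s : x < size s -> exists i, (insert x s).2 = Some i.
Proof.
elim: s => //= a s IH; rewrite ltnS leq_eqVlt.
case: eqP => [-> _|ne] /=.
  by rewrite insert_ge // eqxx; exists 0.
move=> /IH; case: (insert x s) => s2 h /= [i ->].
have /negPf -> : size s != x by apply/eqP => e; case: ne.
by case: ifP => _; eexists.
Qed.

Variant insert_cons_spec a s x : tableau * option nat -> Prop :=
| InsertBit of x = size s : insert_cons_spec a s x (Some 0 :: s, Some 0)
| InsertBump i s2 of x < size s & insert x s = (s2, Some i) & a = Some i :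
    insert_cons_spec a s x (Some i.+1 :: s2, Some i.+1)
| InsertPass i s2 of x < size s & insert x s = (s2, Some i) & a <> Some i :
    insert_cons_spec a s x (a :: s2, Some i).

(** The three cases at the largest entry: it is the new one, it is bumped, or it stays. *)
Lemma insert_consP a s x : x < (size s).+1 -> insert_cons_spec a s x (insert x (a :: s)).
Proof.
rewrite ltnS => xs /=.
case: (eqVneq (size s) x) => [<-|ne].
  by rewrite insert_ge //; exact: InsertBit.
have {ne}xs : x < size s by rewrite ltn_neqAle eq_sym ne.
case E : (insert x s) => [s2 h]; have [i] := insert_some xs; rewrite E /= => hi.
by rewrite hi in E *; case: eqP => ai; [apply: InsertBump | apply: InsertPass].
Qed.

Lemma row_len_cons a s j : row_len (a :: s) j = (a == Some j) + row_len s j.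
Proof. by []. Qed.

Lemma some_eqE (i j : nat) : (Some i == Some j) = (i == j).
Proof. by apply/eqP/eqP => [[->]|->]. Qed.

Lemma row_len_insert x s j : x < size s -> row_at s x = None ->
  row_len (insert x s).1 j = row_len s j + ((insert x s).2 == Some j).
Proof.
elim: s => // a s IH xs /=; rewrite -/(insert x (a :: s)).
case: (insert_consP a xs) => [e|i s2 xs1 E ai|i s2 xs1 E ai] /=.
- by rewrite e eqxx => ->; rewrite !row_len_cons /= !some_eqE; lia.
- rewrite ltn_eqF // => en; move: (IH xs1 en); rewrite E /= !row_len_cons => ->.
  by rewrite ai; lia.
- rewrite ltn_eqF // => en; move: (IH xs1 en); rewrite E /= !row_len_cons => ->.
  by lia.
Qed.

Lemma insertK x s : x < size s -> row_at s x = None ->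
  forall s2 i, insert x s = (s2, Some i) -> uninsert i s2 = (s, x).
Proof.
elim: s => // a s IH xs en s2' i'; case: (insert_consP a xs) en => /=.
- by move=> ->; rewrite eqxx => -> [<- <-].
- move=> i s2 xs1 E ai; rewrite ltn_eqF // => en [<- <-] /=.
  by rewrite eqxx (IH xs1 en _ _ E) ai.
- move=> i s2 xs1 E ai; rewrite ltn_eqF // => en [<- <-] /=.
  by move/eqP/negPf: ai => ->; rewrite (IH xs1 en _ _ E).
Qed.

Lemma standard_row_len s i : standard s -> row_len s i.+1 <= row_len s i.
Proof. by case: s => // a s [_]. Qed.

(** Only a bump can endanger the shape, as it adds a box to the row i.+1.  At that moment the
carry has just given a box to the row i, which was at least as long before. *)
Lemma standard_insert x s : x < size s -> row_at s x = None -> standard s ->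
  standard (insert x s).1.
Proof.
elim: s => // a s IH xs + [ls la] => /=; rewrite -/(insert x (a :: s)).
case: (insert_consP a xs) => [e|i s2 xs1 E ai|i s2 xs1 E ai].
- move=> _; split=> // i; rewrite !row_len_cons !some_eqE; have := standard_row_len i ls.
  by lia.
- rewrite ltn_eqF // => en; have /= := IH xs1 en ls; rewrite E => l2.
  split=> // j; rewrite !row_len_cons !some_eqE.
  have := standard_row_len j l2; have := standard_row_len j ls.
  have := row_len_insert j xs1 en; have := row_len_insert j.+1 xs1 en.
  by rewrite E /= !some_eqE; lia.
- rewrite ltn_eqF // => en; have /= := IH xs1 en ls; rewrite E => l2.
  split=> // j; have := la j; rewrite !row_len_cons.
  have := standard_row_len j l2; have := standard_row_len j ls.
  have := row_len_insert j xs1 en; have := row_len_insert j.+1 xs1 en.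
  rewrite E /= !some_eqE; case: (eqVneq i j.+1) => [ij|_]; last by lia.
  by rewrite -ij; move/eqP/negPf: ai => ->; lia.
Qed.

(** Reverse insertion from a removable corner succeeds: among the entries smaller than the one
that leaves the row i.+1, the row i is strictly longer, so the scan finds its next entry. *)
Lemma uninsertK s i : standard s -> row_len s i.+1 < row_len s i ->
  forall s1 x, uninsert i s = (s1, x) ->
  [/\ size s1 = size s, x < size s1, row_at s1 x = None, standard s1 &
      insert x s1 = (s, Some i) /\ forall j, row_len s j = row_len s1 j + (i == j)].
Proof.
elim: s i => // a s IH i [ls la] ci s1 x /=.
case: eqP => [ai|/eqP ai].
- subst a; case: i la ci => [|i] la ci.
    move=> [<- <-] /=; rewrite eqxx; split=> //.
      by split=> // i; rewrite !row_len_cons /= ; exact: standard_row_len.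
    split; first by rewrite insert_ge // eqxx.
    by move=> j; rewrite !row_len_cons some_eqE /=; lia.
  case E : (uninsert i s) => [s2 y] [<- <-].
  have ci2 : row_len s i.+1 < row_len s i.
    by have := la i; rewrite !row_len_cons !some_eqE eqxx; lia.
  have [sz ys en l2 [iE cE]] := IH _ ls ci2 _ _ E.
  split=> /=; rewrite ?sz //.
  + by rewrite -sz; lia.
  + by rewrite ltn_eqF // -sz.
  + split=> // j; have := standard_row_len j ls; have := la j;
    have := standard_row_len j l2.
    rewrite !row_len_cons !some_eqE (cE j) (cE j.+1); lia.
  + rewrite iE ?eqxx gtn_eqF // -?sz //; split=> // j.
    by rewrite !row_len_cons !some_eqE (cE j); lia.
- case E : (uninsert i s) => [s2 y] [<- <-].
  have ci2 : row_len s i.+1 < row_len s i.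
    by move: ci; rewrite !row_len_cons (negPf ai); lia.
  have [sz ys en l2 [iE cE]] := IH _ ls ci2 _ _ E.
  split=> /=; rewrite ?sz //.
  + by rewrite -sz; lia.
  + by rewrite ltn_eqF // -sz.
  + split=> // j; have := la j; move: ci; rewrite !row_len_cons (cE j) (cE j.+1).
    have := cE i; have := cE i.+1; have := standard_row_len j l2.
    case: (eqVneq i j) => [ij|_].
      by subst j; rewrite (negPf ai) eqxx; lia.
    by case: (eqVneq i j.+1) => [ij|_]; first subst i; lia.
  + rewrite iE (negPf ai) gtn_eqF // -?sz //; split=> // j.
    by rewrite !row_len_cons (cE j); lia.
Qed.

(** * Labelled walks of partitions and their transposes *)

(** The boxes that are added and removed along a path, recorded by their row; [true] inserts
the next letter and [false] removes the largest possible entry, which gives [None] if that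
entry is absent. *)
Fixpoint labels (p : seq bool) (s : tableau) (t : seq nat) : seq (option nat) :=
  match p, t with
  | true :: p', x :: t' => (insert x s).2 :: labels p' (insert x s).1 t'
  | false :: p', _ => head None s :: labels p' (behead s) t
  | _, _ => [::]
  end.

Fixpoint insertable (p : seq bool) (s : tableau) (t : seq nat) : bool :=
  match p, t with
  | [::], _ => nilp s && nilp t
  | true :: p', x :: t' =>
    [&& x < size s, row_at s x == None & insertable p' (insert x s).1 t']
  | true :: _, [::] => false
  | false :: p', _ => (0 < size s) && insertable p' (behead s) t
  end.

(** The walk is read backwards, so that each removed box says in which row the entry was, and
each added box where the reverse insertion starts. *)
Fixpoint unlabels (p : seq bool) (l : seq (option nat)) : tableau * seq nat :=
  match p, l with
  | true :: p', Some i :: l' =>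
    let: (s, t) := unlabels p' l' in let: (s1, x) := uninsert i s in (s1, x :: t)
  | false :: p', a :: l' => let: (s, t) := unlabels p' l' in (a :: s, t)
  | _, _ => ([::], [::])
  end.

Lemma labelsK p s t : insertable p s t -> unlabels p (labels p s t) = (s, t).
Proof.
elim: p s t => [|[] p IH] s t /=.
- by case/andP => /nilP -> /nilP ->.
- case: t => //= x t /and3P[xs /eqP en v].
  have [i E] := insert_some xs; rewrite E (IH _ _ v).
  case E' : (insert x s) => [s2 h] /=; rewrite E' /= in E; rewrite E in E'.
  by rewrite (insertK xs en E').
- by case: s => //= a s /IH ->.
Qed.

Definition add_box (f : nat -> nat) i := fun j => f j + (j == i).
Definition remove_box (f : nat -> nat) i := fun j => f j - (j == i).
(** The functions are the row and the column lengths of the same partition.  That both exist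
forces them to be nonincreasing. *)
Definition conjugate (f g : nat -> nat) := forall i j, (j < f i) = (i < g j).

(** The labels trace partitions that end with the empty one; the second function follows the
conjugate partition, so that transposing a walk only exchanges the two functions. *)
Fixpoint walk (p : seq bool) (f g : nat -> nat) (l : seq (option nat)) : Prop :=
  conjugate f g /\
  match p, l with
  | [::], [::] => f =1 fun=> 0
  | true :: p', Some i :: l' => walk p' (add_box f i) (add_box g (f i)) l'
  | false :: p', Some i :: l' =>
    0 < f i /\ walk p' (remove_box f i) (remove_box g (f i).-1) l'
  | false :: p', None :: l' => walk p' f g l'
  | _, _ => False
  end.

(** The box that is added to the row i lies in the column [f i], and the box removed from it
in the column [(f i).-1]. *)
Fixpoint transpose (p : seq bool) (f : nat -> nat) (l : seq (option nat)) :=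
  match p, l with
  | true :: p', Some i :: l' => Some (f i) :: transpose p' (add_box f i) l'
  | false :: p', Some i :: l' => Some (f i).-1 :: transpose p' (remove_box f i) l'
  | _ :: p', a :: l' => a :: transpose p' f l'
  | _, _ => [::]
  end.

Lemma conjugate_sym f g : conjugate f g -> conjugate g f.
Proof. by move=> c i j; rewrite c. Qed.

Lemma conjugate_anti f g i j : conjugate f g -> i <= j -> f j <= f i.
Proof.
move=> c ij; case: leqP => // fij.
have := c i (f i); rewrite ltnn => /esym/negbT; rewrite -leqNgt => gi.
by move: fij; rewrite c; lia.
Qed.

Lemma walk_conjugate p f g l : walk p f g l -> conjugate f g.
Proof. by case: p => [|[] p] []. Qed.

Lemma conjugate_add_boxE f g i : conjugate f g ->
  conjugate (add_box f i) (add_box g (f i)) -> g (f i) = i.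
Proof.
move=> c c'; have := c i (f i); have := c' i (f i).
by rewrite /add_box !eqxx; lia.
Qed.

Lemma conjugate_remove_boxE f g i : 0 < f i -> conjugate f g ->
  conjugate (remove_box f i) (remove_box g (f i).-1) -> g (f i).-1 = i.+1.
Proof.
move=> fi c c'; have := c i (f i).-1; have := c' i (f i).-1.
by rewrite /remove_box !eqxx; lia.
Qed.

Lemma conjugate_add_box f g i : conjugate f g -> (i = 0 \/ f i < f i.-1) ->
  conjugate (add_box f i) (add_box g (f i)).
Proof.
move=> c fi; have gi : g (f i) = i.
  have := c i (f i); rewrite ltnn => /esym/negbT; rewrite -leqNgt => gi.
  case: fi => [i0|]; first by lia.
  by rewrite c; lia.
move=> a b; have := c a b; rewrite /add_box.
by case: (eqVneq a i) => [->|]; case: (eqVneq b (f i)) => [->|]; lia.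
Qed.

Lemma conjugate_remove_box f g i : conjugate f g -> f i.+1 < f i ->
  conjugate (remove_box f i) (remove_box g (f i).-1).
Proof.
move=> c fi; have gi : g (f i).-1 = i.+1.
  by have := c i (f i).-1; have := c i.+1 (f i).-1; lia.
move=> a b; have := c a b; rewrite /remove_box.
by case: (eqVneq a i) => [->|]; case: (eqVneq b (f i).-1) => [->|]; lia.
Qed.

Lemma walk_transpose p f g l : walk p f g l ->
  walk p g f (transpose p f l) /\ transpose p g (transpose p f l) = l.
Proof.
elim: p f g l => [|[] p IH] f g l /= [c].
- case: l => // f0; split=> //; split; first exact: conjugate_sym.
  by move=> j /=; have := c 0 j; rewrite f0; lia.
- case: l => // -[] // i l w.
  have e := conjugate_add_boxE c (walk_conjugate w).
  have [w1 w2] := IH _ _ _ w; rewrite /= e w2.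
  by split; first by split; first exact: conjugate_sym.
- case: l => // -[i|] l.
    move=> [fi w]; have e := conjugate_remove_boxE fi c (walk_conjugate w).
    have [w1 w2] := IH _ _ _ w; rewrite /= e w2.
    by split; first by split; [exact: conjugate_sym | split].
  by move/IH => [w1 w2] /=; rewrite w2; split; first by split; first exact: conjugate_sym.
Qed.

Lemma labels_walk p s t g : insertable p s t -> standard s -> conjugate (row_len s) g ->
  walk p (row_len s) g (labels p s t).
Proof.
elim: p s t g => [|[] p IH] s t g /=.
- by case/andP => /nilP -> _ _ c; split.
- case: t => // x t /and3P[xs /eqP en v] ls c; split=> //.
  have [i E] := insert_some xs; rewrite E.
  have ei : row_len (insert x s).1 = add_box (row_len s) i.
    by apply: functional_extensionality => j; rewrite row_len_insert // E some_eqE eq_sym.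
  have l2 := standard_insert xs en ls.
  rewrite -ei; apply: IH => //; rewrite ei; apply: conjugate_add_box => //.
  case: i ei {E} => [|i] ei; first by left.
  by right; have := standard_row_len i l2; rewrite ei /add_box eqxx /=; lia.
- case: s => //= a s v [ls la] c; split=> //.
  case: a la c => [i|] la c; last first.
    by have e : row_len (None :: s) = row_len s; rewrite // e in c *; apply: IH.
  have ei : row_len s = remove_box (row_len (Some i :: s)) i.
    by apply: functional_extensionality => j;
      rewrite /remove_box row_len_cons some_eqE eq_sym addKn.
  have lt : row_len (Some i :: s) i.+1 < row_len (Some i :: s) i.
    by have := standard_row_len i ls; rewrite !row_len_cons !some_eqE eqxx; lia.
  split; first by rewrite row_len_cons eqxx.
  by rewrite -ei; apply: IH => //; rewrite [row_len s]ei; apply: conjugate_remove_box.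
Qed.

(** Every walk that ends with the empty partition comes from a word. *)
Lemma unlabels_walk p f g l : walk p f g l ->
  let: (s, t) := unlabels p l in
  [/\ standard s, row_len s = f, insertable p s t & labels p s t = l].
Proof.
elim: p f g l => [|[] p IH] f g l /= [c].
- case: l => // f0; split=> //.
  by apply: functional_extensionality => j; rewrite f0.
- case: l => // -[] // i l w; have := IH _ _ _ w.
  case: (unlabels p l) => s t [ls cs v r].
  case E : (uninsert i s) => [s1 x].
  (* The row i has just received a box, so it ends in a corner. *)
  have lt : row_len s i.+1 < row_len s i.
    by have := conjugate_anti c (leqnSn i); rewrite cs /add_box eqxx; lia.
  have [sz xs en l1 [iE cE]] := uninsertK ls lt E.
  split; rewrite /= ?iE ?xs ?en ?v ?r //.
  apply: functional_extensionality => j; have := cE j; rewrite cs /add_box eq_sym; lia.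
- case: l => // -[i|] l.
    move=> [fi w]; have := IH _ _ _ w.
    case: (unlabels p l) => s t [ls cs v r].
    have e : row_len (Some i :: s) = f.
      apply: functional_extensionality => j;
        rewrite row_len_cons cs /remove_box some_eqE eq_sym.
      by case: (eqVneq j i) => [->|_]; lia.
    split=> //=; rewrite ?r // e; split=> // j; exact: conjugate_anti c (leqnSn j).
  move/IH; case: (unlabels p l) => s t [ls cs v r].
  have e : row_len (None :: s) = f by [].
  by split=> //=; rewrite ?r // e; split=> // j; exact: conjugate_anti c (leqnSn j).
Qed.

(** * The boundary of a diagram as a path *)

Lemma row_at_some s r : row_at s r -> r < size s.
Proof. by elim: s => //= a s IH; case: eqP => [-> //|_ /IH]; exact: ltnW. Qed.

Lemma row_at_none s r : size s <= r -> row_at s r = None.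
Proof. by case E : row_at => [i|] //; rewrite leqNgt row_at_some ?E. Qed.

Lemma row_at_insert x s r : x < size s -> row_at s x = None ->
  isSome (row_at (insert x s).1 r) = isSome (row_at s r) || (r == x).
Proof.
elim: s => // a s IH xs; case: (insert_consP a xs) => [e|i s2 xs1 E ai|i s2 xs1 E ai].
- by rewrite e /= eqxx => ->; case: eqP => // _; rewrite orbF.
- rewrite /= ltn_eqF // => en; have := IH xs1 en; rewrite E /=.
  have -> : size s2 = size s by rewrite -(size_insert x s) E.
  by case: (eqVneq r (size s)) => // _ _; rewrite ai.
- rewrite /= ltn_eqF // => en; have := IH xs1 en; rewrite E /=.
  have -> : size s2 = size s by rewrite -(size_insert x s) E.
  by case: (eqVneq r (size s)) => // -> _; rewrite gtn_eqF ?orbF.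
Qed.

(** The row bumping lemma: a larger letter adds a box strictly to the right of the previous
one, a smaller letter adds one strictly below it.  Both statements survive each step of the
scan. *)
Lemma insert_compare x y s i j : x < size s -> row_at s x = None -> y < size s ->
  row_at (insert x s).1 y = None -> (insert x s).2 = Some i ->
  (insert y (insert x s).1).2 = Some j -> (x < y) = (j <= i).
Proof.
elim: s i j => // a s IH i j xs.
case: (insert_consP a xs) => [e|i1 s2 xs1 E ai|i1 s2 xs1 E ai] en ys.
- case: (insert_consP (Some 0) ys); rewrite /= ?e.
  + by move=> ->; rewrite eqxx.
  + by move=> k s3 ys1 E [<-] _ [<-] [<-]; lia.
  + move=> k s3 ys1 E k0 _ [<-] [<-]; case: k E k0 => // k _ _.
    by rewrite ltnNge ltnW.
- have sz : size s2 = size s by rewrite -(size_insert x s) E.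
  rewrite /= -sz in ys; case: (insert_consP (Some i1.+1) ys).
  + by move=> e /=; rewrite e eqxx.
  + move=> k s3 ys1 E3 [ik] /=; rewrite ltn_eqF // => en2 [<-] [<-].
    rewrite sz in ys1; rewrite /= ltn_eqF // in en.
    have := IH i1 k xs1 en ys1; rewrite E /= E3 => /(_ en2 erefl erefl) ->.
    by lia.
  + move=> k s3 ys1 E3 ik /=; rewrite ltn_eqF // => en2 [<-] [<-].
    rewrite sz in ys1; rewrite /= ltn_eqF // in en.
    have := IH i1 k xs1 en ys1; rewrite E /= E3 => /(_ en2 erefl erefl) ->.
    by have : k <> i1.+1 by [move=> e; apply: ik; rewrite e]; lia.
- have sz : size s2 = size s by rewrite -(size_insert x s) E.
  rewrite /= -sz in ys; case: (insert_consP a ys).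
  + move=> e /=; rewrite e eqxx => _ [<-] [<-].
    by rewrite sz xs1.
  + move=> k s3 ys1 E3 ak /=; rewrite ltn_eqF // => en2 [<-] [<-].
    rewrite sz in ys1; rewrite /= ltn_eqF // in en.
    have := IH i1 k xs1 en ys1; rewrite E /= E3 => /(_ en2 erefl erefl) ->.
    by have : k <> i1 by [move=> e; apply: ai; rewrite ak e]; lia.
  + move=> k s3 ys1 E3 ak /=; rewrite ltn_eqF // => en2 [<-] [<-].
    rewrite sz in ys1; rewrite /= ltn_eqF // in en.
    by have := IH i1 k xs1 en ys1; rewrite E /= E3 => /(_ en2 erefl erefl) ->.
Qed.

(** Only two letters with no removal between them are compared; the entry is [true] where there
is nothing to compare. *)
Fixpoint cmp_letters (e : rel nat) (p : seq bool) (t : seq nat) : seq bool :=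
  match p, t with
  | true :: p', x :: t' =>
    (match p', t' with true :: _, y :: _ => e x y | _, _ => true end)
      :: cmp_letters e p' t'
  | false :: p', _ => cmp_letters e p' t
  | _, _ => [::]
  end.

Fixpoint cmp_labels (e : rel nat) (p : seq bool) (l : seq (option nat)) : seq bool :=
  match p, l with
  | true :: p', a :: l' =>
    match p', l' with
    | true :: _, b :: _ => e (odflt 0 a) (odflt 0 b)
    | _, _ => true
    end :: cmp_labels e p' l'
  | false :: p', _ :: l' => cmp_labels e p' l'
  | _, _ => [::]
  end.

Lemma cmp_letters_labels p s t : insertable p s t ->
  cmp_letters ltn p t = cmp_labels geq p (labels p s t) /\ cmp_letters gtn p t =
    cmp_labels ltn p (labels p s t).
Proof.
elim: p s t => [|[] p IH] s t //=; last by case/andP => _ /IH.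
case: t => // x t /and3P[xs /eqP en v]; have [-> ->] := IH _ _ v.
have [i Ei] := insert_some xs.
case: p v {IH} => [|[] p] //; case: t => [|y t] //.
move=> /= /and3P[ys /eqP en2 v]; have [j Ej] := insert_some ys.
rewrite size_insert in ys; have e := insert_compare xs en ys en2 Ei Ej.
rewrite Ei Ej /= /geq /= -e; split=> //; congr (_ :: _).
have ne : x != y.
  apply/eqP => xy; move: en2; rewrite -xy => en2.
  by have := row_at_insert x xs en; rewrite en2 eqxx orbT.
by lia.
Qed.

(** A box weakly above the previous one is strictly to its right, and after transposing
strictly below it. *)
Lemma cmp_labels_transpose p f g l : walk p f g l ->
  cmp_labels ltn p (transpose p f l) = cmp_labels geq p l.
Proof.
elim: p f g l => [|[] p IH] f g l /= [c]; case: l => //; last first.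
  by move=> [i|] l; [case=> _ /IH /= -> | move/IH => /= ->].
move=> -[] // i l w /=; rewrite (IH _ _ _ w); congr (_ :: _).
case: p w {IH} => [|[] p] //; case: l => [|[j|] l] //=; try by case.
move=> [c' w]; have := conjugate_anti c (i:=i) (j:=j).
have := conjugate_anti c' (i:=j) (j:=i).
by rewrite /add_box !eqxx /geq /=; case: (ltngtP i j) => ij; lia.
Qed.

(** Absent entries stay absent, so transposing keeps the set of rows that contain a 1. *)
Lemma transpose_isSome p f g l : walk p f g l ->
  map isSome (mask (map negb p) (transpose p f l)) = map isSome (mask (map negb p) l).
Proof.
elim: p f g l => [|[] p IH] f g l /= [c]; case: l => // -[i|] l //=.
- exact: IH.
- by case=> _ /IH ->.
- by move/IH ->.
Qed.

Lemma insertable_lt p s t : insertable p s t -> all (fun x => x < size s) t.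
Proof.
elim: p s t => [|[] p IH] s t /=; first by case/andP => _ /nilP ->.
- by case: t => // x t /and3P[xs _ /IH] /=; rewrite size_insert xs.
- case/andP => s0 /IH; rewrite size_behead; apply: sub_all => x; lia.
Qed.

Lemma labels_isSome p s t : insertable p s t ->
  map isSome (mask (map negb p) (labels p s t)) =
  [seq isSome (row_at s r) || (r \in t) | r <- rev (iota 0 (size s))].
Proof.
elim: p s t => [|[] p IH] s t /=; first by case/andP => /nilP ->.
- case: t => // x t /and3P[xs /eqP en /IH] /= ->; rewrite size_insert.
  by apply: eq_map => r; rewrite row_at_insert // inE orbA.
- case: s => //= a s v; rewrite (IH _ _ v).
  have -> : rev (0 :: iota 1 (size s)) = size s :: rev (iota 0 (size s)).
    by rewrite -[_ :: iota _ _]/(iota 0 (size s).+1) -addn1 iotaD rev_cat.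
  rewrite /= eqxx.
  have /negPf -> : size s \notin t.
    by apply/negP => /(allP (insertable_lt v)); rewrite ltnn.
  rewrite orbF; congr (_ :: _); apply/eq_in_map => r.
  by rewrite mem_rev mem_iota /= => rs; rewrite ltn_eqF.
Qed.

(** The path along the lower right boundary of the diagram with column lengths [hs]: before
the column of length h is passed, the rows from h on are removed. *)
Fixpoint boundary (H : nat) (hs : seq nat) : seq bool :=
  if hs is h :: hs' then nseq (H - h) false ++ true :: boundary h hs'
  else nseq H false.

Lemma insertable_cat d p s t :
  insertable (nseq d false ++ p) s t = (d <= size s) && insertable p (drop d s) t.
Proof.
elim: d s => [|d IH] s /=; first by rewrite drop0.
by rewrite IH -drop1 drop_drop addn1 size_drop; case: s => //=; lia.
Qed.

Lemma labels_cat d p s t : d <= size s ->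
  labels (nseq d false ++ p) s t = take d s ++ labels p (drop d s) t.
Proof. by elim: d s => [|d IH] [|a s] //= ds; rewrite IH. Qed.

Lemma row_at_drop s d r : r < size s - d -> row_at (drop d s) r = row_at s r.
Proof.
elim: d s => [|d IH] [|a s] //= rd; rewrite IH; last by lia.
by rewrite ltn_eqF //; lia.
Qed.

Lemma insertable_boundary hs s t : path geq (size s) hs -> size t = size hs ->
  uniq t -> all2 ltn t hs -> all (fun x => row_at s x == None) t ->
  insertable (boundary (size s) hs) s t.
Proof.
elim: hs s t => [|h hs IH] s [|x t] //=.
  by move=> *; rewrite -[nseq _ _]cats0 insertable_cat leqnn drop_size.
move=> /andP[hs0 ph] [st] /andP[xt ut] /andP[xh at_] /andP[/eqP ex en].
rewrite insertable_cat leq_subr /=; set s1 := drop _ s.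
have sz : size s1 = h by rewrite size_drop subKn.
have e1 y : row_at s y == None -> row_at s1 y = None.
  move/eqP => ey; case: (ltnP y h) => yh; last by rewrite row_at_none ?sz.
  by rewrite row_at_drop ?subKn.
rewrite sz xh e1 ?ex //=; rewrite -sz -(size_insert x s1).
apply: IH => //; rewrite ?size_insert ?sz //.
apply/allP => y yt; rewrite -[_ == _]negbK -/(~~ _); apply/negP => sy.
have : isSome (row_at (insert x s1).1 y) by case: row_at sy.
rewrite row_at_insert ?sz ?e1 ?ex // ?(allP en y yt) //=.
by move/eqP => yx; rewrite -yx yt in xt.
Qed.

Lemma boundary_insertable hs s t : path geq (size s) hs ->
  insertable (boundary (size s) hs) s t ->
  [/\ size t = size hs, uniq t, all2 ltn t hs &
      all (fun x => row_at s x == None) t].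
Proof.
elim: hs s t => [|h hs IH] s t /=.
  by rewrite -[nseq _ _]cats0 insertable_cat => _ /andP[_ /andP[_ /nilP ->]].
move=> /andP[hs0 ph]; rewrite insertable_cat leq_subr /=; set s1 := drop _ s.
have sz : size s1 = h by rewrite size_drop subKn.
case: t => // x t /and3P[xs /eqP en]; rewrite -{1}sz -(size_insert x s1) => v.
have [|st ut at_ et] := IH _ _ _ v; first by rewrite size_insert sz.
have e1 y : y \in x :: t -> isSome (row_at s1 y) || (y == x) = (y == x).
  rewrite inE => /orP[/eqP->|yt]; first by rewrite eqxx orbT.
  by have := row_at_insert y xs en;
    rewrite (eqP (allP et y yt)) => /esym/norP[/negPf -> _].
have xt : x \notin t.
  apply/negP => /(allP et) /eqP ex.
  by have := row_at_insert x xs en; rewrite ex eqxx orbT.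
rewrite /= st xt ut at_ -{1}sz xs; split=> //.
have e2 y : y < h -> row_at s1 y = row_at s y by move=> yh; rewrite row_at_drop ?subKn.
rewrite -e2 ?en -?sz //=; apply/allP => y yt.
have yh : y < h.
  by have := allP (insertable_lt v) y yt; rewrite size_insert sz.
rewrite -e2 //; have := row_at_insert y xs en; rewrite (eqP (allP et y yt)) /=.
by case: (row_at s1 y).
Qed.

Lemma nth_cmp_letters e H hs t i : path geq H hs -> size t = size hs ->
  i.+1 < size hs -> nth 0 hs i = nth 0 hs i.+1 ->
  nth true (cmp_letters e (boundary H hs) t) i = e (nth 0 t i) (nth 0 t i.+1).
Proof.
elim: hs H t i => [|h hs IH] H [|x t] i //= /andP[_ ph] [st] ih ehs.
have -> : cmp_letters e (nseq (H - h) false ++ true :: boundary h hs) (x :: t) =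
  cmp_letters e (true :: boundary h hs) (x :: t) by elim: (H - h).
case: i ih ehs => [|i] ih ehs; last by rewrite /= IH.
case: hs t ph st ih ehs {IH} => [|h' hs] [|y t] //= ph st ih ->.
by rewrite subnn.
Qed.

(** * Tableaux of prefixes *)

(** The bound h on the letters stands for the rows that are left when the path reaches height h. *)
Definition chain (r : rel nat) (w : seq nat) (k h : nat) : Prop :=
  exists u, [/\ subseq u w, sorted r u, size u = k & all (fun x => x < h) u].

Definition insert_word (s : tableau) (w : seq nat) : tableau :=
  foldl (fun s x => (insert x s).1) s w.

Definition fits (s : tableau) (w : seq nat) : bool :=
  uniq w && all (fun x => (x < size s) && (row_at s x == None)) w.

Lemma insert_word_rcons s w x : insert_word s (rcons w x) =
  (insert x (insert_word s w)).1.
Proof. by rewrite /insert_word foldl_rcons. Qed.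

Lemma size_insert_word s w : size (insert_word s w) = size s.
Proof. by elim: w s => //= x w IH s; rewrite IH size_insert. Qed.

Lemma fits_cons s x w : fits s (x :: w) ->
  [/\ x < size s, row_at s x = None, x \notin w, fits s w & fits (insert x s).1 w].
Proof.
move=> /andP[/= /andP[xw uw] /andP[/andP[xs /eqP ex] aw]].
split=> //; rewrite /fits uw //=; apply/allP => y yw; rewrite size_insert.
have /andP[-> /eqP ey] := allP aw y yw; have := row_at_insert y xs ex.
by rewrite ey; case: eqP => [e|_]; [rewrite -e yw in xw | case: row_at].
Qed.

Lemma fits_rcons s w x : fits s (rcons w x) ->
  [/\ fits s w, x \notin w,
    x < size (insert_word s w) & row_at (insert_word s w) x = None].
Proof.
rewrite size_insert_word; elim: w s => [|y w IH] s f.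
  by have [xs ex _ _ _] := fits_cons f.
have [ys ey yw fs fs'] := fits_cons f.
have [fw xw xs ex] := IH _ fs'; split=> //.
- have [/andP[uw aw] _ _ _] := IH _ fs.
  rewrite mem_rcons inE negb_or in yw; case/andP: yw => _ yw.
  by rewrite /fits /= yw uw ys ey.
- rewrite inE negb_or xw andbT; apply/eqP => xy.
  by rewrite mem_rcons xy mem_head in yw.
- by rewrite size_insert in xs.
Qed.

Lemma size_nseqN (n : nat) : size (nseq n (@None nat)) = n.
Proof. exact: size_nseq. Qed.

Lemma row_at_nseq n r : row_at (nseq n None) r = None.
Proof. by elim: n => //= n ->; rewrite if_same. Qed.

Lemma fits_nseq n w : fits (nseq n None) w = uniq w && all (fun x => x < n) w.
Proof.
congr (_ && _); apply: eq_all => x.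
by rewrite size_nseq row_at_nseq eqxx andbT.
Qed.

Lemma insert_word_cons a s w : uniq w -> all (fun x => row_at (a :: s) x == None) w ->
  exists b, insert_word (a :: s) w = b :: insert_word s w.
Proof.
elim: w a s => [|x w IH] a s /=; first by exists a.
move=> /andP[xw uw] /andP[/eqP ex aw].
have : exists b, (insert x (a :: s)).1 = b :: (insert x s).1.
  case: (ltnP x (size s).+1) => [xs|xs]; last by exists a; rewrite !insert_ge //=; lia.
  case: (insert_consP a xs) => [->|i s2 _ ->|i s2 _ ->] /=.
  - by rewrite insert_ge //; eexists.
  - by eexists.
  - by eexists.
move=> [b E]; rewrite E; apply: IH => //.
apply/allP => y yw; move: (allP aw y yw).
case: (ltnP x (size (a :: s))) => xs; last by rewrite -E insert_ge.
have := row_at_insert y xs ex; rewrite E.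
case: (eqVneq y x) => [e|_]; first by rewrite -e yw in xw.
rewrite orbF => eE /eqP ey; move: eE; rewrite [in RHS]/= ey.
by case: (row_at (b :: _) y).
Qed.

(** The entries below r of the tableau of w.  Letters that are at least r are ignored by
[insert], so the tableau is defined for any word. *)
Notation tab r w := (insert_word (nseq r None) w).

Lemma tab_cons w r : uniq w -> exists b, tab r.+1 w = b :: tab r w.
Proof. by move=> uw; apply: insert_word_cons => //; apply/allP => y _; apply/eqP;
  exact: (row_at_nseq r.+1 y). Qed.

Lemma row_at_tab w r x : uniq w -> isSome (row_at (tab r w) x) = (x < r) && (x \in w).
Proof.
elim/last_ind: w x => [|w y IH] x; first by rewrite row_at_nseq andbF.
rewrite rcons_uniq insert_word_rcons => /andP[yw uw]; rewrite mem_rcons inE.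
case: (ltnP y r) => yr.
  rewrite row_at_insert ?size_insert_word ?size_nseq //.
    by rewrite IH //; case: eqP => [->|_]; rewrite ?yr ?orbT ?orbF.
  by move: (IH y uw); rewrite (negPf yw) andbF; case: (row_at _ y).
rewrite insert_ge ?size_insert_word ?size_nseq // IH //.
by case: eqP => // ->; rewrite ltnNge yr.
Qed.

(** * Increasing subsequences and the first row *)

Lemma subseq_rcons2 (u w : seq nat) x y :
  subseq (rcons u y) (rcons w x) =
  if y == x then subseq u w else subseq (rcons u y) w.
Proof.
rewrite -subseq_rev !rev_rcons /=.
by case: eqP => // _; rewrite -?rev_rcons subseq_rev.
Qed.

Lemma sorted_rconsE (r : rel nat) u x : transitive r ->
  sorted r (rcons u x) = sorted r u && all (r^~ x) u.
Proof.
move=> rtr; rewrite -rev_sorted rev_rcons /= path_sortedE; last first.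
  by move=> a b c ab bc; apply: rtr bc ab.
by rewrite all_rev rev_sorted andbC.
Qed.

Lemma gtn_trans : transitive gtn.
Proof. by move=> y x z; rewrite /gtn /=; lia. Qed.

Lemma chain_rcons r w x k h : transitive r -> (forall a, r a x = (a < x)) ->
  chain r (rcons w x) k h <->
  chain r w k h \/ [/\ x < h, 0 < k & chain r w k.-1 x].
Proof.
move=> rtr rx; split.
- case=> u []; case/lastP: u => [|u y].
    by move=> _ _ <- _; left; exists [::]; rewrite sub0seq.
  rewrite subseq_rcons2 sorted_rconsE // size_rcons all_rcons.
  case: eqP => [->|_] su /andP[so al] <- /andP[yh ah].
    right; split=> //; exists u; split=> //.
    by apply: sub_all al => a; rewrite rx.
  by left; exists (rcons u y); rewrite sorted_rconsE // size_rcons all_rcons so al yh ah.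
- case=> [[u [su so sz al]]|[xh k0 [u [su so sz al]]]].
    by exists u; split=> //; apply: subseq_trans su _; exact: subseq_rcons.
  exists (rcons u x); split.
  + by rewrite subseq_rcons2 eqxx.
  + by rewrite sorted_rconsE // so; apply: sub_all al => a; rewrite rx.
  + by rewrite size_rcons sz prednK.
  + by rewrite all_rcons xh; apply: sub_all al => a; move: xh; lia.
Qed.

Lemma tab_rcons r w x : tab r (rcons w x) = (insert x (tab r w)).1.
Proof. exact: insert_word_rcons. Qed.

Lemma size_tab r w : size (tab r w) = r.
Proof. by rewrite size_insert_word size_nseq. Qed.

Lemma row_at_tab_none r w x : uniq w -> x \notin w -> row_at (tab r w) x = None.
Proof.
by move=> uw xw; have := row_at_tab r x uw; rewrite (negPf xw) andbF; case: row_at.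
Qed.

Lemma row0_len_mono r s w : uniq w -> r <= s ->
  row_len (tab r w) 0 <= row_len (tab s w) 0.
Proof.
move=> uw /subnK <-; elim: (s - r) => [|d IH]; first by [].
by rewrite addSn; have [b ->] := tab_cons (d + r) uw;
  rewrite row_len_cons (leq_trans IH) ?leq_addl.
Qed.

(** The carry is still in the first row when no entry of that row exceeds x. *)
Lemma carry_row0 r w x : uniq w -> x \notin w -> x < r ->
  ((insert x (tab r w)).2 == Some 0) = (row_len (tab r w) 0 == row_len (tab x w) 0).
Proof.
move=> uw xw; elim: r => // r IH xr; have [b E] := tab_cons r uw.
have xs : x < (size (tab r w)).+1 by rewrite size_tab.
have en := row_at_tab_none r.+1 uw xw; rewrite E in en *.
case: (insert_consP b xs) en => [e|i s2|i s2]; rewrite ?size_tab.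
- rewrite size_tab in e; rewrite /= size_tab -e !eqxx => ->.
  by rewrite row_len_cons /= e eqxx.
- move=> {}xr Ei -> _; have := IH xr; have := row0_len_mono uw (ltnW xr).
  by rewrite Ei /= row_len_cons !some_eqE; lia.
- move=> {}xr Ei bi _; have := IH xr; have := row0_len_mono uw (ltnW xr).
  rewrite Ei /= row_len_cons !some_eqE; case: (eqVneq b (Some 0)) => [b0|_]; last by lia.
  by have i0 : i <> 0 by [move=> i0; rewrite b0 i0 in bi]; lia.
Qed.

(** The recursion for the longest increasing subsequence with letters below r. *)
Lemma row0_len_rcons r w x : uniq (rcons w x) ->
  row_len (tab r (rcons w x)) 0 =
  if x < r then maxn (row_len (tab r w) 0) (row_len (tab x w) 0).+1 else row_len (tab r
    w) 0.
Proof.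
rewrite rcons_uniq tab_rcons => /andP[xw uw].
case: (ltnP x r) => xr; last by rewrite insert_ge ?size_tab.
rewrite row_len_insert ?size_tab ?row_at_tab_none // carry_row0 //.
by have := row0_len_mono uw (ltnW xr); lia.
Qed.

(** Schensted's theorem for increasing subsequences. *)
Lemma chain_ltnP w k r : uniq w -> chain ltn w k r <-> k <= row_len (tab r w) 0.
Proof.
elim/last_ind: w k r => [|w x IH] k r uw.
  split=> [[u []]|].
    by rewrite subseq0 => /eqP -> _ <-.
  have -> : row_len (tab r [::]) 0 = 0 by rewrite /row_len /=; elim: r.
  by rewrite leqn0 => /eqP ->; exists [::].
have uw' : uniq w by move: uw; rewrite rcons_uniq => /andP[].
rewrite chain_rcons //; last exact: ltn_trans.
rewrite row0_len_rcons // !IH //; case: ltnP => xr; last by split=> [[|[]]|]; lia.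
split=> [[|[_ k0 /(IH _ _ uw')]]|]; [lia|lia|].
case: (posnP k) => [->|k0]; first by left.
by rewrite leq_max => /orP[->|kx]; [left | right; split=> //; apply/IH => //]; lia.
Qed.

(** * Decreasing subsequences and the first column *)

Definition in_row0 (s : tableau) (r : nat) : bool := row_at s r == Some 0.

Fixpoint bump_target (x : nat) (s : tableau) : option nat :=
  if s is a :: s1 then
    if bump_target x s1 is Some y then Some y
    else if (x < size s1) && (a == Some 0) then Some (size s1) else None
  else None.

Definition lower_row (a : option nat) : option nat :=
  if a is Some i.+1 then Some i else None.

(** The letters expelled from the first row, in order.  Inserting them builds the rows below
the first one ([lower_insert_word]), which is the reason for the induction on rows. *)
Fixpoint bumped (s : tableau) (w : seq nat) : seq nat :=
  if w is x :: w' then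
    (if bump_target x s is Some y then [:: y] else [::]) ++ bumped (insert x s).1 w'
  else [::].

Lemma in_row0_lt s r : in_row0 s r -> r < size s.
Proof. by move/eqP => e; apply: row_at_some; rewrite e. Qed.

Lemma bump_targetP x s :
  match bump_target x s with
  | Some y => [/\ x < y, in_row0 s y & forall z, in_row0 s z -> x < z -> y <= z]
  | None => forall z, in_row0 s z -> z <= x
  end.
Proof.
rewrite /in_row0; elim: s => [z|a s]; first by [].
rewrite /=; case: (bump_target x s) => [y [xy ry my]|ny].
  have ys := in_row0_lt ry; rewrite (ltn_eqF ys); split=> // z.
  by case: (eqVneq z (size s)) => [-> _ _|_]; [exact: ltnW | exact: my].
case: andP => [[xs /eqP ->]|nxs]; last first.
  move=> z; case: (eqVneq z (size s)) => [-> a0|_ /ny //].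
  by rewrite leqNgt; apply/negP => xs; apply: nxs.
rewrite eqxx; split=> // z; case: (eqVneq z (size s)) => [-> //|_ /ny]; lia.
Qed.

Lemma bump_target_ge x s : size s <= x.+1 -> bump_target x s = None.
Proof.
have := bump_targetP x s; case: bump_target => // y [xy /in_row0_lt ys _] sx; lia.
Qed.

Lemma lower_row_eq a i : (lower_row a == Some i) = (a == Some i.+1).
Proof. by case: a => [[|j]|] //=; rewrite !some_eqE. Qed.

Lemma insert_bump_target x s : x < size s -> row_at s x = None ->
  match bump_target x s with
  | Some y => insert y (map lower_row s) = (map lower_row (insert x s).1,
    lower_row (insert x s).2)
              /\ (insert x s).2 <> Some 0
  | None => (insert x s).2 = Some 0 /\ map lower_row (insert x s).1 = map lower_row s
  end.
Proof.
elim: s => // a s IH xs.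
case: (insert_consP a xs) => [e|i s2 xs1 Ei ai|i s2 xs1 Ei ai].
- by rewrite /= e eqxx bump_target_ge // ltnn => ->.
- rewrite /= ltn_eqF // => en; have := IH xs1 en; have := bump_targetP x s.
  case: (bump_target x s) => [y [xy ry _] []|_]; rewrite Ei /=.
    move=> -> i0; split=> //; rewrite size_map gtn_eqF; last exact: in_row0_lt.
    by case: i ai i0 {Ei} => // i -> _ /=; rewrite eqxx.
  move=> [[i0] E2]; rewrite ai i0 xs1 /= !size_map insert_ge ?size_map // eqxx.
  by rewrite E2.
- rewrite /= ltn_eqF // => en; have := IH xs1 en; have := bump_targetP x s.
  case: (bump_target x s) => [y [xy ry _] []|_]; rewrite Ei /=.
    move=> -> i0; split=> //; rewrite size_map gtn_eqF; last exact: in_row0_lt.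
    case: i ai i0 {Ei} => // i ai _ /=; rewrite lower_row_eq.
    by case: eqP.
  move=> [[i0] E2]; move: ai; rewrite i0 => /eqP/negPf ->; rewrite andbF /=.
  by rewrite E2.
Qed.

Lemma in_row0_insert x s r : x < size s -> row_at s x = None ->
  in_row0 (insert x s).1 r = (r == x) || (in_row0 s r && (bump_target x s != Some r)).
Proof.
rewrite /in_row0; elim: s => // a s IH xs.
case: (insert_consP a xs) => [e|i s2 xs1 Ei ai|i s2 xs1 Ei ai].
- rewrite /= e eqxx bump_target_ge // ltnn /= => ->; case: (eqVneq r (size s)) => //= _.
  by rewrite andbT.
- rewrite /= ltn_eqF // => en; have := IH xs1 en; have := insert_bump_target xs1 en.
  have sz : size s2 = size s by rewrite -(size_insert x s) Ei.
  rewrite Ei /= sz; case: (eqVneq r (size s)) => [-> h _|ne h ->].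
    rewrite (gtn_eqF xs1) /= some_eqE ai some_eqE.
    move: h; have := bump_targetP x s;
      case: (bump_target x s) => [y [_ /in_row0_lt ys _] [_ i0]|_ [[->] _]].
      by case: i i0 {ai Ei} => // [[]].
    by rewrite xs1 !eqxx.
  case: (bump_target x s) h => // -[[i0] _]; rewrite ai i0 xs1 eqxx /= some_eqE.
  by rewrite [size s == r]eq_sym (negPf ne).
- rewrite /= ltn_eqF // => en; have := IH xs1 en; have := insert_bump_target xs1 en.
  have sz : size s2 = size s by rewrite -(size_insert x s) Ei.
  rewrite Ei /= sz; case: (eqVneq r (size s)) => [-> h _|ne h ->].
    rewrite (gtn_eqF xs1) /=.
    move: h; have := bump_targetP x s;
      case: (bump_target x s) => [y [_ /in_row0_lt ys _] _|_ [[i0] _]].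
      by rewrite some_eqE ltn_eqF // andbT.
    by rewrite -i0; case: eqP ai => //= -> ; rewrite andbF.
  case: (bump_target x s) h => // -[[i0] _]; rewrite -i0 xs1.
  by move: ai => /eqP/negPf ->.
Qed.

Lemma lower_insert_word s w : fits s w ->
  map lower_row (insert_word s w) = insert_word (map lower_row s) (bumped s w).
Proof.
elim: w s => //= x w IH s f; have [xs ex _ _ f2] := fits_cons f.
rewrite (IH _ f2); have := insert_bump_target xs ex.
by case: (bump_target x s) => [y [E _]|[_ E]] /=; rewrite E.
Qed.

Definition bumped_chain (s : tableau) (w : seq nat) (y : nat) (u : seq nat) :=
  exists b : seq nat, [/\ subseq b (bumped s w), sorted gtn b, size b = size u &
                all (fun z => z <= y) b].

(** A decreasing subsequence of w yields one of the bumped letters that is shorter by one: once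
a letter smaller than an entry y of the first row has been inserted, y or an entry between the
two has been bumped.  In the first statement the entry y is already present; the second
one waits until it is inserted. *)
Lemma bumped_chainP s w : fits s w ->
  (forall y u, in_row0 s y -> subseq u w -> sorted gtn (y :: u) ->
     bumped_chain s w y u) /\
  (forall y u, subseq (y :: u) w -> sorted gtn (y :: u) -> bumped_chain s w y u).
Proof.
elim: w s => [|x w IH] s f.
  split=> // y u _ ; rewrite subseq0 => /eqP -> _; by exists [::].
have [xs ex xw _ f2] := fits_cons f; have [IH1 IH2] := IH _ f2.
have rx : in_row0 (insert x s).1 x by rewrite in_row0_insert // eqxx.
have weak y u : bumped_chain (insert x s).1 w y u -> bumped_chain s (x :: w) y u.
  move=> [b [sb so sz al]]; exists b; split=> //=.
  exact: subseq_trans sb (suffix_subseq _ _).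
have claim2 y u : subseq (y :: u) (x :: w) -> sorted gtn (y :: u) ->
  bumped_chain s (x :: w) y u.
  move=> /=; case: (eqVneq y x) => [->|yx] su so; apply: weak; last exact: IH2.
  exact: IH1.
split=> // y u ry su so.
have xyne : x != y by apply/eqP => xy; move: ry; rewrite /in_row0 -xy ex.
case: u su so => [|u1 u] su so; first by exists [::]; rewrite sub0seq.
have [yu1 so1] := andP so; rewrite /gtn /= in yu1.
have u1x u0 y0 : bumped_chain s (x :: w) u1 u0 -> bumped_chain s (x :: w) y u0 by
  move=> [b [sb sob sz al]]; exists b; split=> //; apply: sub_all al => z; lia.
have := bump_targetP x s; case E : (bump_target x s) => [z|]; last first.
  move=> /(_ _ ry) yx; move: su => /=; case: (eqVneq u1 x) => [|_ su]; first lia.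
  by apply: weak; apply: IH1 => //; rewrite in_row0_insert // E andbT ry orbT.
move=> [xz rz mz]; move: su => /=; case: (eqVneq u1 x) => [u1x1|_] su.
  have zy : z <= y by apply: mz => //; rewrite -u1x1.
  have [b [sb sob sz al]] := IH1 x u rx su ltac:(by rewrite -u1x1).
  exists (z :: b); rewrite /= E /= eqxx sb sz zy /=; split=> //.
    rewrite path_sortedE; last exact: gtn_trans.
    by rewrite sob andbT; apply: sub_all al => a /=; rewrite /gtn /=; lia.
  by apply: sub_all al => a; lia.
case: (eqVneq z y) => [zy|zy]; last first.
  apply: weak; apply: IH1 => //; rewrite in_row0_insert // ry E orbC /=.
  by rewrite some_eqE zy.
(* The letter x bumps y itself; u1 comes later, above or below x. *)
case: (ltngtP x u1) => [xu1|u1x1|xu1].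
- have [b [sb sob sz al]] := IH2 _ _ su so1.
  exists (y :: b); rewrite /= E zy /= eqxx sb sz leqnn /=; split=> //.
    rewrite path_sortedE; last exact: gtn_trans.
    by rewrite sob andbT; apply: sub_all al => a /=; rewrite /gtn /=; lia.
  by apply: sub_all al => a; lia.
- have [|b [sb sob sz al]] := IH1 x (u1 :: u) rx su.
    by rewrite /= /gtn /= u1x1.
  apply: weak; exists b; split=> //; apply: sub_all al => a.
  by move=> /leq_trans -> //; rewrite -zy ltnW.
- by rewrite -xu1 in su; move: (mem_subseq su (mem_head _ _)); rewrite (negPf xw).
Qed.

Lemma bumped_rcons s w x : bumped s (rcons w x) =
  bumped s w ++ (if bump_target x (insert_word s w) is Some y then [:: y] else [::]).
Proof. by elim: w s => [|y w IH] s /=; rewrite ?cats0 // IH catA. Qed.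

Lemma in_row0_insert_word s w y : fits s w -> in_row0 (insert_word s w) y ->
  in_row0 s y || (y \in w).
Proof.
elim/last_ind: w => [|w x IH] /=; first by rewrite orbF.
move=> /fits_rcons [f xw xs ex]; rewrite insert_word_rcons in_row0_insert //.
rewrite mem_rcons inE => /orP[->|/andP[/IH]]; first by rewrite orbT.
by move=> /(_ f) /orP[->|->] //; rewrite !orbT.
Qed.

(** Conversely, a decreasing subsequence of the bumped letters yields one of w that is longer
by one.  It ends with the letter x that bumped z, and the letter v before it may be used for
any entry y of the first row between x and z: such an entry came after x had bumped z, for
otherwise x would have bumped it instead.  This clause decides the next step: the next bumped letter is followed by the
letter that bumps it, which extends the sequence if the bumped letter is at most x, and
otherwise the bumped letter takes the place of x. *)
Lemma chain_of_bumped H w b z : fits (nseq H None) w ->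
  subseq (rcons b z) (bumped (nseq H None) w) -> sorted gtn (rcons b z) ->
  exists u v x, [/\ size u = size b, subseq (rcons (rcons u v) x) w,
    sorted gtn (rcons (rcons u v) x), z <= v /\ x < z &
    forall y, in_row0 (tab H w) y -> x < y < z -> subseq (rcons (rcons u v) y) w].
Proof.
elim/last_ind: w b z => [|w x' IH] b z; first by case: b.
move=> f; have [fw xw xs ex] := fits_rcons f.
have old : subseq (rcons b z) (bumped (nseq H None) w) -> sorted gtn (rcons b z) ->
  exists u v x, [/\ size u = size b, subseq (rcons (rcons u v) x) (rcons w x'),
    sorted gtn (rcons (rcons u v) x), z <= v /\ x < z &
    forall y, in_row0 (tab H (rcons w x')) y -> x < y < z ->
    subseq (rcons (rcons u v) y) (rcons w x')].
  move=> sb so; have [u [v [x [su sw so' zv hy]]]] := IH _ _ fw sb so.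
  have ww : subseq w (rcons w x') by exact: subseq_rcons.
  exists u, v, x; split=> //; first exact: subseq_trans ww.
  move=> y; rewrite insert_word_rcons in_row0_insert // => /orP[/eqP ->
    _|/andP[ry _] xyz].
    rewrite subseq_rcons2 eqxx; apply: subseq_trans sw; exact: subseq_rcons.
  by apply: subseq_trans ww; apply: hy.
rewrite bumped_rcons; have := bump_targetP x' (tab H w).
case: (bump_target x' _) => [z'|]; last by rewrite cats0.
move=> [xz rz mz]; rewrite cats1 subseq_rcons2.
case: eqP => [->|_]; last exact: old.
have noy u v y : in_row0 (tab H (rcons w x')) y -> x' < y < z' ->
    subseq (rcons (rcons u v) y) (rcons w x').
  rewrite insert_word_rcons in_row0_insert // => /orP[/eqP ->|/andP[ry _]]; first lia.
  by have := mz y ry; lia.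
have zw : z' \in w.
  by have := in_row0_insert_word fw rz; rewrite /in_row0 row_at_nseq.
case/lastP: b {old} => [|b z1] sb so.
  exists [::], z', x'; split=> //; last exact: noy.
    by rewrite subseq_rcons2 eqxx sub1seq.
  by rewrite /= /gtn /= xz.
move: so; rewrite sorted_rconsE; last exact: gtn_trans.
rewrite all_rcons /gtn /= => /and3P[so zz1 _].
have [u [v [x [su sw so' [zv xz1] hy]]]] := IH _ _ fw sb so.
(* If z' exceeds x, then it came after x and takes its place. *)
case: (leqP z' x) => z'x.
  exists (rcons u v), x, x'; split=> //.
  - by rewrite !size_rcons su.
  - by rewrite subseq_rcons2 eqxx.
  - rewrite sorted_rconsE ?so' /=; last exact: gtn_trans.
    move: so'; rewrite sorted_rconsE; last exact: gtn_trans.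
    move=> /andP[_ al]; rewrite all_rcons /gtn /= (leq_trans xz z'x) /=.
    by apply: sub_all al => a; rewrite /gtn /=; lia.
  - exact: noy.
have swz : subseq (rcons (rcons u v) z') w by apply: hy => //; rewrite z'x.
have so2 : sorted gtn (rcons (rcons u v) z').
  move: so'; rewrite !sorted_rconsE; try exact: gtn_trans.
  rewrite !all_rcons /gtn /= => /and3P[/andP[-> al] _ _]; rewrite al /=.
  rewrite (leq_trans zz1 zv); apply: sub_all al => a; rewrite /gtn /=; lia.
exists (rcons u v), z', x'; split=> //.
- by rewrite !size_rcons su.
- by rewrite subseq_rcons2 eqxx.
- rewrite sorted_rconsE ?so2 /=; last exact: gtn_trans.
  move: so2; rewrite sorted_rconsE; last exact: gtn_trans.
  move=> /andP[_ al]; rewrite all_rcons /gtn /= xz /=.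
  by apply: sub_all al => a; rewrite /gtn /=; lia.
- exact: noy.
Qed.

Lemma mem_bumped s w y : fits s w -> y \in bumped s w -> in_row0 s y || (y \in w).
Proof.
elim/last_ind: w => [|w x IH] //; rewrite bumped_rcons => /fits_rcons [f xw xs ex].
rewrite mem_cat => /orP[/(IH f) /orP[->//|yw]|].
  by rewrite mem_rcons inE yw !orbT.
have := bump_targetP x (insert_word s w); case: (bump_target _ _) => // z [_ rz _];
  rewrite inE => /eqP ->.
by have /orP[->|zw] := in_row0_insert_word f rz; rewrite // mem_rcons inE zw !orbT.
Qed.

Lemma uniq_bumped s w : fits s w -> uniq (bumped s w).
Proof.
elim: w s => //= x w IH s f; have [xs ex xw fs f2] := fits_cons f.
have := bump_targetP x s; case E : (bump_target x s) => [y|];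
  rewrite ?IH //= => -[xy ry _].
rewrite IH // andbT; apply/negP => /(mem_bumped f2) /orP[|yw].
  by rewrite in_row0_insert // E eqxx andbF orbF => /eqP yx; rewrite yx ltnn in xy.
move: f => /andP[_ /andP[_ /allP /(_ _ yw)]].
by move: ry; rewrite /in_row0 => /eqP -> /andP[].
Qed.

Lemma map_lower_nseq H : map lower_row (nseq H None) = nseq H None.
Proof. by rewrite map_nseq. Qed.

Lemma mem_some0 s : (Some 0 \in s) = has (in_row0 s) (iota 0 (size s)).
Proof.
elim: s => // a s IH; rewrite [size _]/= -addn1 iotaD has_cat /= orbF add0n.
rewrite inE IH orbC eq_sym /in_row0 /= eqxx; congr (_ || _).
by apply: eq_in_has => r; rewrite mem_iota => /= rs; rewrite ltn_eqF.
Qed.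

(** By induction on rows, as the longest decreasing subsequence loses one letter when the first
row is removed. *)
Lemma mem_tab_decreasing H w j : fits (nseq H None) w ->
  (Some j \in tab H w) <->
  (exists u, [/\ subseq u w, sorted gtn u & size u = j.+1]).
Proof.
elim: j w => [|j IH] w f.
  split.
    rewrite mem_some0 => /hasP[r _ /(in_row0_insert_word f)].
    rewrite {1}/in_row0 row_at_nseq /= => rw; exists [:: r]; split=> //.
    by rewrite sub1seq.
  case=> u [xw _]; case: u xw => [|x [|y u]] // xw _; rewrite sub1seq in xw.
  case/lastP: w xw f => // w y _ f; have [fw yw ys ey] := fits_rcons f.
  rewrite mem_some0; apply/hasP; exists y.
    by rewrite mem_iota /= insert_word_rcons size_insert.
  by rewrite insert_word_rcons in_row0_insert // eqxx.
have fb : fits (nseq H None) (bumped (nseq H None) w).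
  rewrite fits_nseq uniq_bumped //; apply/allP => y /(mem_bumped f).
  rewrite /in_row0 row_at_nseq /=; move: f; rewrite fits_nseq => /andP[_].
  by move/allP; apply.
have -> : (Some j.+1 \in tab H w) = (Some j \in tab H (bumped (nseq H None) w)).
  rewrite -[X in insert_word X (bumped _ _)]map_lower_nseq -lower_insert_word //.
  elim: (tab H w) => // a s IHs; rewrite /= !inE -IHs eq_sym [Some j == _]eq_sym.
  by rewrite lower_row_eq.
rewrite (IH _ fb); split=> [[u [su so sz]]|[u [su so sz]]].
  case/lastP: u su so sz => // b z su so; rewrite size_rcons => -[sz].
  have [u [v [x [sz' sw so' _ _]]]] := chain_of_bumped f su so.
  by exists (rcons (rcons u v) x); rewrite !size_rcons sz' sz.
case: u su so sz => // y u su so [sz].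
have [b [sb sob szb _]] := (bumped_chainP f).2 _ _ su so.
by exists b; rewrite szb.
Qed.

Lemma tab_filter H w : tab H w = tab H (filter (fun x => x < H) w).
Proof.
elim/last_ind: w => // w x IH; rewrite filter_rcons tab_rcons IH.
by case: (ltnP x H) => xH; rewrite ?tab_rcons // insert_ge // size_tab.
Qed.

(** Schensted's theorem for decreasing subsequences. *)
Lemma chain_gtnP w k r : uniq w -> chain gtn w k.+1 r <-> (Some k \in tab r w).
Proof.
move=> uw; rewrite tab_filter mem_tab_decreasing; last first.
  by rewrite fits_nseq filter_uniq // filter_all.
split=> -[u [su so sz]].
  by move=> al; exists u; rewrite subseq_filter al.
move: su; rewrite subseq_filter => /andP[al su].
by exists u.
Qed.

(** * The involution exchanging increasing and decreasing chains *)

Definition chainb (r : rel nat) (w : seq nat) (k h : nat) : bool :=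
  [exists m : (size w).-tuple bool,
    [&& sorted r (mask m w), size (mask m w) == k & all (fun x => x < h) (mask m w)]].

Lemma chainP r w k h : reflect (chain r w k h) (chainb r w k h).
Proof.
apply: (iffP existsP) => [[m /and3P[so /eqP sz al]]|[u [/subseqP[m sm ->] so sz al]]].
  by exists (mask m w); rewrite mask_subseq.
have szm : size m == size w by rewrite sm.
by exists (Tuple szm); rewrite /= so sz eqxx.
Qed.

(** A chain in the columns up to c lies in the diagram if its rows are below the length of the
column c, and its own last column may serve as c. *)
Definition has_chain (r : rel nat) (k : nat) (hs t : seq nat) : bool :=
  has (fun c => chainb r (take c.+1 t) k (nth 0 hs c)) (iota 0 (size t)).

Definition fills (hs t : seq nat) : bool :=
  [&& size t == size hs, uniq t & all2 ltn t hs].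

(** The filling whose walk is the transpose of the walk of t. *)
Definition flip (hs t : seq nat) : seq nat :=
  let p := boundary (head 0 hs) hs in
  (unlabels p (transpose p (fun=> 0) (labels p (nseq (head 0 hs) None) t))).2.

(** Chains are longest just after a box has been added, so only those shapes are tested. *)
Fixpoint all_added (Q : (nat -> nat) -> Prop) (p : seq bool) (f : nat -> nat)
    (l : seq (option nat)) : Prop :=
  match p, l with
  | true :: p', Some i :: l' => Q (add_box f i) /\ all_added Q p' (add_box f i) l'
  | false :: p', Some i :: l' => all_added Q p' (remove_box f i) l'
  | _ :: p', _ :: l' => all_added Q p' f l'
  | _, _ => True
  end.

Lemma all_added_transpose (Q Q' : (nat -> nat) -> Prop) p f g l : walk p f g l ->
  (forall f g, conjugate f g -> Q f <-> Q' g) ->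
  all_added Q p f l <-> all_added Q' p g (transpose p f l).
Proof.
move=> w QQ; elim: p f g l w => [|[] p IH] f g l //= [c]; case: l => // -[] //.
- move=> i l w; have c' := walk_conjugate w; rewrite /=.
  by rewrite (QQ _ _ c') (IH _ _ _ w).
- by move=> i l [fi w]; exact: IH.
- by move=> l /IH.
Qed.

Lemma row_len_behead i s : row_len s = remove_box (row_len (Some i :: s)) i.
Proof.
by apply: functional_extensionality => j;
  rewrite /remove_box row_len_cons some_eqE eq_sym addKn.
Qed.

Lemma row_len_insertE x s i : x < size s -> row_at s x = None ->
  (insert x s).2 = Some i -> row_len (insert x s).1 = add_box (row_len s) i.
Proof.
move=> xs ex E.
by apply: functional_extensionality => j; rewrite row_len_insert // E some_eqE eq_sym.
Qed.

Lemma all_added_cat Q d p s l : d <= size s ->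
  all_added Q (nseq d false ++ p) (row_len s) (take d s ++ l) <->
    all_added Q p (row_len (drop d s)) l.
Proof.
elim: d s => [|d IH] s; first by rewrite take0 drop0.
case: s => // -[i|] s ds /=; last by rewrite -IH.
by rewrite -row_len_behead IH.
Qed.

Lemma drop_tab d h w : uniq w -> drop d (tab (d + h) w) = tab h w.
Proof.
move=> uw; elim: d => [|d IH]; first by rewrite drop0.
by rewrite addSn; have [b ->] := tab_cons (d + h) uw.
Qed.

Lemma all_added_labels Q H hs w t : path geq H hs -> uniq (w ++ t) ->
  insertable (boundary H hs) (tab H w) t -> size t = size hs ->
  all_added Q (boundary H hs) (row_len (tab H w)) (labels (boundary H hs) (tab H w) t) <->
  forall c, c < size t -> Q (row_len (tab (nth 0 hs c) (w ++ take c.+1 t))).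
Proof.
elim: hs H w t => [|h hs IH] H w [|x t] //=.
  by rewrite -[nseq _ _]cats0 labels_cat ?size_tab // all_added_cat ?size_tab.
move=> /andP[hH ph] uwt; rewrite insertable_cat => /andP[ds] v [st].
rewrite labels_cat // all_added_cat //.
have uw : uniq w by move: uwt; rewrite cat_uniq => /andP[].
have dS : drop (H - h) (tab H w) = tab h w.
  by rewrite -{2}(subnK hH) drop_tab.
move: v; rewrite dS /= => /and3P[xs /eqP ex v].
have [i Ei] := insert_some xs; rewrite Ei -(row_len_insertE xs ex Ei).
have uw' : uniq (rcons w x ++ t) by rewrite cat_rcons.
rewrite -!tab_rcons in v *; rewrite (IH h (rcons w x) t) //.
split=> [[q0 q] [|c] ct|q]; first by rewrite take0 cats1.
  by rewrite -cat_rcons; apply: q.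
split; first by have := q 0 isT; rewrite take0 cats1.
by move=> c ct; rewrite cat_rcons; apply: (q c.+1).
Qed.

Lemma insertable_size p s t : insertable p s t -> size s = count negb p.
Proof.
elim: p s t => [|[] p IH] s t /=; first by case/andP => /nilP ->.
- by case: t => // x t /and3P[_ _ /IH]; rewrite size_insert.
- by case: s => //= a s /IH ->.
Qed.

Lemma row_len0_nseq s : row_len s = (fun=> 0) -> s = nseq (size s) None.
Proof.
elim: s => // a s IH e.
have e0 j : (a == Some j) + row_len s j = 0 by rewrite -row_len_cons e.
rewrite /= -IH; last by apply: functional_extensionality => j; have := e0 j; lia.
by case: a e0 {e} => // i /(_ i); rewrite eqxx.
Qed.

Lemma row_len_nseq n : row_len (nseq n None) = fun=> 0.
Proof.
by apply: functional_extensionality => j; elim: n => //= n; rewrite row_len_cons.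
Qed.

Lemma standard_nseq n : standard (nseq n None).
Proof. by elim: n => //= n IH; split=> // i; rewrite !row_len_cons row_len_nseq. Qed.

Section Flip.

Variable hs : seq nat.
Hypothesis hs_sorted : sorted geq hs.

Let H := head 0 hs.
Let p := boundary H hs.
Let s0 : tableau := nseq H None.

Lemma path_head : path geq H hs.
Proof. by rewrite /H; case: hs hs_sorted => //= h hs' ->; rewrite /geq /= leqnn. Qed.

Lemma fills_insertable t : fills hs t -> insertable p s0 t.
Proof.
case/and3P => /eqP st ut at_; rewrite /p -(size_nseqN H).
apply: insertable_boundary => //; rewrite ?size_nseq //; first exact: path_head.
by apply/allP => x _; rewrite row_at_nseq.
Qed.

Lemma insertable_fills t : insertable p s0 t -> fills hs t.
Proof.
rewrite /p -[in boundary _](size_nseqN H) => v.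
have [] := boundary_insertable _ v; first by rewrite size_nseq; exact: path_head.
by rewrite /fills => -> -> -> _; rewrite eqxx.
Qed.

Lemma labels_walk0 t : fills hs t -> walk p (fun=> 0) (fun=> 0) (labels p s0 t).
Proof.
move/fills_insertable => v; rewrite -{1}(row_len_nseq H).
by apply: labels_walk => //; rewrite ?row_len_nseq //; exact: standard_nseq.
Qed.

Lemma flip_spec t : fills hs t ->
  insertable p s0 (flip hs t) /\ labels p s0 (flip hs t) =
    transpose p (fun=> 0) (labels p s0 t).
Proof.
move=> wt; have := unlabels_walk (walk_transpose (labels_walk0 wt)).1.
rewrite /flip -/H -/p -/s0; case: (unlabels _ _) => s t' [ls cs v r] /=.
suff e : s = s0 by rewrite e in v r.
rewrite (row_len0_nseq cs) (insertable_size v) -(insertable_size (fills_insertable wt)).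
by rewrite size_nseq.
Qed.

Lemma fills_flip t : fills hs t -> fills hs (flip hs t).
Proof. by case/flip_spec => /insertable_fills. Qed.

Lemma flipK t : fills hs t -> flip hs (flip hs t) = t.
Proof.
move=> wt; have [_ r] := flip_spec wt.
rewrite {1}/flip -/H -/p -/s0 r (walk_transpose (labels_walk0 wt)).2.
by rewrite (labelsK (fills_insertable wt)).
Qed.

Lemma perm_flip t : fills hs t -> perm_eq (flip hs t) t.
Proof.
move=> wt; have [v r] := flip_spec wt; have v0 := fills_insertable wt.
have [/and3P[_ u _] /and3P[_ u0 _]] := (insertable_fills v, insertable_fills v0).
apply: uniq_perm => // x; have := labels_isSome v; rewrite r.
rewrite (transpose_isSome (labels_walk0 wt)) (labels_isSome v0) => /eq_in_map e.
case: (ltnP x H) => xH.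
  by have := e x; rewrite mem_rev mem_iota size_nseq row_at_nseq => /(_ xH) /= ->.
have notin t' : insertable p s0 t' -> x \notin t'.
  by move/insertable_lt/allP => a; apply/negP => /a; rewrite size_nseq ltnNge xH.
by rewrite (negPf (notin _ v)) (negPf (notin _ v0)).
Qed.

Lemma flip_asc t i : fills hs t -> i.+1 < size hs ->
  nth 0 hs i = nth 0 hs i.+1 ->
  (nth 0 (flip hs t) i.+1 < nth 0 (flip hs t) i) = (nth 0 t i < nth 0 t i.+1).
Proof.
move=> wt ih ehs; have [v r] := flip_spec wt; have v0 := fills_insertable wt.
have /and3P[/eqP st _ _] := wt; have /and3P[/eqP st' _ _] := fills_flip wt.
have e1 := nth_cmp_letters ltn path_head st ih ehs.
have e2 := nth_cmp_letters gtn path_head st' ih ehs.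
rewrite /= in e1; rewrite -e1; rewrite /gtn /= in e2; rewrite -e2.
have [_ ->] := cmp_letters_labels v; have [-> _] := cmp_letters_labels v0.
by rewrite r (cmp_labels_transpose (labels_walk0 wt)).
Qed.

(** The first row has at least k boxes exactly when the transposed shape has at least k rows. *)
Lemma flip_chain k t : 0 < k -> fills hs t ->
  has_chain gtn k hs (flip hs t) = has_chain ltn k hs t.
Proof.
move=> k0 wt; have [v r] := flip_spec wt; have v0 := fills_insertable wt.
have /and3P[/eqP st u _] := wt; have /and3P[/eqP st' u' _] := fills_flip wt.
have a1 := @all_added_labels (fun f => f 0 < k) _ _ [::] _ path_head u v0 st.
have a2 := @all_added_labels (fun f => f k.-1 = 0) _ _ [::] _ path_head u' v st'.
rewrite -/p /= -/s0 row_len_nseq in a1 a2.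
have QQ f g : conjugate f g -> f 0 < k <-> g k.-1 = 0 by move=> c; have := c 0 k.-1; lia.
have a3 := all_added_transpose (labels_walk0 wt) QQ; rewrite -r a1 a2 in a3.
apply: negb_inj; apply/idP/idP => /hasPn h; apply/hasPn => c.
  rewrite mem_iota /= => ct; apply/chainP; rewrite chain_ltnP ?take_uniq //.
  apply/negP; rewrite -ltnNge; apply: (a3.2 _ c ct) => {ct}c ct.
  have := h c; rewrite mem_iota /= => /(_ ct) /chainP.
  rewrite -(prednK k0) chain_gtnP ?take_uniq // => /negP ns.
  by apply/count_memPn.
rewrite mem_iota /= => ct; apply/chainP.
rewrite -(prednK k0) chain_gtnP ?take_uniq //; apply/negP/count_memPn.
apply: (a3.1 _ c ct) => {ct}c ct.
have := h c; rewrite mem_iota /= => /(_ ct) /chainP.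
by rewrite chain_ltnP ?take_uniq // => /negP; rewrite -ltnNge.
Qed.

End Flip.

(** * Valley words *)

(** With [ltn] the word has no interior peak, with [gtn] it has no interior valley. *)
Fixpoint no_peak (r : rel nat) (v : seq nat) : bool :=
  match v with
  | x :: v1 => (if v1 is y :: z :: _ then ~~ (r x y && r z y) else true) && no_peak r v1
  | [::] => true
  end.

Lemma no_peakP r v : reflect
  (forall i, i.+2 < size v ->
    ~~ (r (nth 0 v i) (nth 0 v i.+1) && r (nth 0 v i.+2) (nth 0 v i.+1)))
  (no_peak r v).
Proof.
elim: v => [|x v IH]; first by left.
rewrite [no_peak _ _]/=; apply: (iffP andP) => [[h /IH p] [|i]|h].
- by case: v h {IH p} => [|y [|z v]].
- exact: p.
- split; last by apply/IH => i iv; apply: (h i.+1).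
  by case: v h {IH} => [|y [|z v]] // h; apply: (h 0).
Qed.

Lemma no_peak_rev r v : no_peak r (rev v) = no_peak r v.
Proof.
have imp w : no_peak r w -> no_peak r (rev w).
  move/no_peakP => h; apply/no_peakP => i; rewrite size_rev => iw.
  rewrite !nth_rev; try lia.
  have e1 : size w - i.+1 = (size w - i.+3).+2 by lia.
  have e2 : size w - i.+2 = (size w - i.+3).+1 by lia.
  by rewrite e1 e2 andbC; apply: h; lia.
by apply/idP/idP => /imp //; rewrite revK.
Qed.

(** The general word without interior peak on the sorted letters X: the marked letters decrease
on the left of the smallest one, the others increase on its right. *)
Definition valley_word (X : seq nat) (d : bitseq) : seq nat :=
  if X is x0 :: X' then rev (mask d X') ++ x0 :: mask (map negb d) X' else [::].

(** The mark of a letter now refers to its predecessor: the letters whose successor is marked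
decrease on the right of the largest one.  This shift makes the increasing subsequences
equally long. *)
Definition hill_word (X : seq nat) (d : bitseq) : seq nat :=
  rev (valley_word (rev X) (rev d)).

(** Consecutive letters, with the mark of the larger one. *)
Definition gaps (X : seq nat) (d : bitseq) := zip (zip X (behead X)) d.

Lemma sorted_sub_subseq (r : rel nat) (s1 s2 : seq nat) : transitive r -> irreflexive r ->
  sorted r s1 -> sorted r s2 -> {subset s1 <= s2} -> subseq s1 s2.
Proof.
move=> rtr ir so1 so2 sub; suff -> : s1 = filter (mem s1) s2 by exact: filter_subseq.
apply: (irr_sorted_eq rtr ir) => //; first exact: sorted_filter.
by move=> x; rewrite mem_filter /=; case: (boolP (x \in s1)) => // /sub ->.
Qed.

Lemma subseq_catP (T : eqType) (u a b : seq T) : subseq u (a ++ b) ->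
  exists u1 u2, [/\ u = u1 ++ u2, subseq u1 a & subseq u2 b].
Proof.
case/subseqP => m sm ->; exists (mask (take (size a) m) a), (mask (drop (size a) m) b).
rewrite !mask_subseq -mask_cat ?cat_take_drop //.
by rewrite size_takel // sm size_cat leq_addr.
Qed.

Lemma sub_count_in (T : eqType) (s : seq T) (a1 a2 : pred T) :
  {in s, forall x, a1 x -> a2 x} -> count a1 s <= count a2 s.
Proof.
elim: s => //= x s IH h; apply: leq_add; last first.
  by apply: IH => y ys; apply: h; rewrite inE ys orbT.
by case: (a1 x) (h x (mem_head _ _)) => // ->.
Qed.

Section Valley.

Variable (r le : rel nat).
Hypothesis r_trans : transitive r.
Hypothesis r_irr : irreflexive r.
Hypothesis le_r : forall x y, le x y = (x == y) || r x y.
Hypothesis r_total : forall x y, x != y -> r x y || r y x.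

Lemma r_asym x y : r x y -> r y x = false.
Proof. by move=> xy; apply/negP => yx; have := r_trans xy yx; rewrite r_irr. Qed.

Lemma r_le_trans x y z : r x y -> le y z -> r x z.
Proof. by rewrite le_r => xy /orP[/eqP <-|/(r_trans xy)]. Qed.

Lemma le_r_trans x y z : le x y -> r y z -> r x z.
Proof. by rewrite le_r => /orP[/eqP <-|xy /(r_trans xy)]. Qed.

Lemma path_all x s : path r x s = all (r x) s && sorted r s.
Proof. exact: path_sortedE. Qed.

(** For letters lo and hi of a valley word, the number of these gaps, plus one, is the length of
the longest increasing subsequence with letters between lo and hi. *)
Definition free_gap (lo hi : nat) (q : nat * nat * bool) :=
  [&& ~~ q.2, le lo q.1.1 & le q.1.2 hi].

Lemma mask_gaps x0 X d : size d = size X ->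
  mask (map negb d) X = [seq q.1.2 | q <- gaps (x0 :: X) d & ~~ q.2].
Proof.
elim: X x0 d => [|x1 X IH] x0 [|b d] //= [sd].
by rewrite (IH x1) //; case: b.
Qed.

Lemma mem_gaps x0 X d q : q \in gaps (x0 :: X) d ->
  (q.1.1 \in x0 :: X) && (q.1.2 \in X).
Proof.
elim: X x0 d => [|x1 X IH] x0 [|b d] //=.
rewrite inE => /orP[/eqP -> /=|/IH /andP[h1 h2]]; first by rewrite !mem_head.
by rewrite inE h1 orbT inE h2 orbT.
Qed.

Lemma gaps_consecutive x0 X d q : q \in gaps (x0 :: X) d -> sorted r (x0 :: X) ->
  r q.1.1 q.1.2 /\ forall y, y \in x0 :: X -> r y q.1.2 -> le y q.1.1.
Proof.
elim: X x0 d => [|x1 X IH] x0 [|b d] //=.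
rewrite inE => /orP[/eqP -> /=|qt] /andP[r01 pX].
  split=> // y; rewrite inE le_r => /orP[-> //|yX].
  move: yX; rewrite inE => /orP[/eqP ->|yX]; first by rewrite r_irr.
  by move: pX; rewrite path_all => /andP[/allP /(_ _ yX) /r_asym ->].
have [h1 h2] := IH _ _ qt pX; split=> // y; rewrite inE => /orP[/eqP ->|]; last exact: h2.
have /andP[q1 _] := mem_gaps qt.
have x1q : le x1 q.1.1.
  move: q1; rewrite inE le_r eq_sym => /orP[->//|qX].
  by move: pX; rewrite path_all => /andP[/allP /(_ _ qX) ->]; rewrite orbT.
by move=> _; rewrite le_r (r_le_trans r01 x1q) orbT.
Qed.

(** After its first letter an increasing subsequence of a valley word uses only letters on the
right of the smallest one, and each of them closes an unmarked gap. *)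
Lemma valley_word_bound X d y c : sorted r X -> size d = (size X).-1 ->
  subseq (y :: c) (valley_word X d) -> sorted r (y :: c) ->
  size c <= count (free_gap y (last y c)) (gaps X d).
Proof.
case: X => // x0 X so sd sc soc.
set E := mask (map negb d) X; set D := mask d X.
have soX : sorted r X by move: so => /=; case: (X) => //= ? ? /andP[].
have x0X : all (r x0) X by move: so; rewrite /= path_all => /andP[].
have [rc soc'] : all (r y) c /\ sorted r c.
  by move: soc; rewrite /= path_all => /andP[].
have yX : y \in x0 :: X.
  move: (mem_subseq sc (mem_head _ _)); rewrite /= mem_cat mem_rev !inE.
  by case/or3P => [/mem_mask ->|->|/mem_mask ->]; rewrite ?orbT.
have cE : subseq c E.
  have x0E z : z :: c = y :: c -> subseq (z :: c) (x0 :: E) -> subseq c E.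
    by move=> _ /=; case: eqP => // _ /(subseq_trans (subseq_cons _ _)).
  move: sc => /= /subseq_catP [c1 [c2 [e s1 s2]]].
  case: c1 e s1 => [|z c1] /= e s1; first by rewrite -e in s2; exact: x0E s2.
  case: e => e1 e2; subst z.
  (* The left part decreases, so it contains at most one letter of the subsequence. *)
  have c10 : c1 = [::].
    case: c1 e2 s1 => // z c1 e2 s1.
    have : sorted (fun a b => r b a) (rev D).
      by rewrite rev_sorted; exact: sorted_mask.
    move/(subseq_sorted _ s1) => /(_ (fun _ _ _ h1 h2 => r_trans h2 h1)) /= /andP[zy _].
    by move: rc; rewrite e2 /= (r_asym zy).
  rewrite c10 /= in e2; rewrite -e2 in s2.
  case: c rc s2 {x0E soc soc' e2} => [|z c] rc; first by rewrite !sub0seq.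
  move=> /=; case: eqP => // zx0; move: rc; rewrite zx0 /= => /andP[yx0 _].
  move: yX; rewrite inE => /orP[/eqP e|/(allP x0X)]; first by rewrite e r_irr in yx0.
  by rewrite (r_asym yx0).
have cb : all (fun z => r y z && le z (last y c)) c.
  apply/allP => z zc; rewrite (allP rc z zc) /= le_r.
  case/lastP: c zc soc' {soc sc rc cE} => // c w; rewrite mem_rcons inE last_rcons.
  case/orP => [->//|zc]; rewrite -rev_sorted rev_rcons /= path_sortedE.
    by move=> /andP[/allP /(_ z)]; rewrite mem_rev zc => ->; rewrite ?orbT.
  by move=> a b e h1 h2; apply: r_trans h2 h1.
have : subseq c [seq z <- E | r y z && le z (last y c)] by rewrite subseq_filter cb.
move/size_subseq => /leq_trans; apply.
rewrite /E (mask_gaps x0) // filter_map size_map -filter_predI size_filter.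
apply: sub_count_in => q qt; have [_ h] := gaps_consecutive qt so.
by rewrite /free_gap /= => /andP[/andP[yq ->] ->]; rewrite (h y yX yq).
Qed.

(** Take lo, wherever it stands, and then the upper ends of all unmarked gaps up to hi. *)
Lemma valley_word_exists X d lo hi : sorted r X -> size d = (size X).-1 ->
  lo \in X -> le lo hi ->
  exists c, [/\ subseq c (valley_word X d), sorted r c,
    size c = (count (free_gap lo hi) (gaps X d)).+1 &
    all (fun z => le lo z && le z hi) c].
Proof.
case: X => // x0 X so sd loX lohi.
set E := mask (map negb d) X; set D := mask d X.
have soX : sorted r X by move: so => /=; case: (X) => //= ? ? /andP[].
have x0X : all (r x0) X by move: so; rewrite /= path_all => /andP[].
pose F := [seq q.1.2 | q <- gaps (x0 :: X) d & free_gap lo hi q].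
have FE : subseq F E.
  rewrite /F /E (mask_gaps x0) //; apply: map_subseq.
  rewrite (_ : [seq q <- _ | free_gap lo hi q] =
     filter (fun q => le lo q.1.1 && le q.1.2 hi) [seq q <- gaps (x0 :: X) d | ~~ q.2]).
    exact: filter_subseq.
  by rewrite -filter_predI; apply: eq_filter => q; rewrite /free_gap /= [RHS]andbC.
have soE : sorted r E by apply: sorted_mask.
have soF : sorted r F by apply: subseq_sorted FE soE.
have loF : all (fun z => r lo z && le z hi) F.
  apply/allP => z /mapP[q]; rewrite mem_filter => /andP[/and3P[_ h1 h2] qt ->].
  have [q12 _] := gaps_consecutive qt so.
  by rewrite h2 (le_r_trans h1 q12).
have soloF : sorted r (lo :: F).
  by rewrite /= path_all soF andbT; apply: sub_all loF => z /andP[->].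
have allF : all (fun z => le lo z && le z hi) (lo :: F).
  rewrite /= le_r eqxx lohi /=; apply: sub_all loF => z /andP[h ->].
  by rewrite le_r h orbT.
exists (lo :: F); split=> //; last by rewrite /= /F size_map size_filter.
have soE0 : sorted r (x0 :: E).
  by rewrite /= path_all soE andbT; apply/allP => z /mem_mask /(allP x0X).
case: (boolP (lo \in x0 :: E)) => loE.
  apply: subseq_trans (suffix_subseq _ _).
  apply: (sorted_sub_subseq r_trans r_irr) => // z;
    rewrite inE => /orP[/eqP -> //|/(mem_subseq FE) zE].
  by rewrite inE zE orbT.
rewrite -cat1s; apply: cat_subseq; last first.
  exact: subseq_trans FE (subseq_cons _ _).
rewrite sub1seq mem_rev; move: loX loE; rewrite !inE negb_or.
case: eqP => //= _ loX loE; move: loX loE; rewrite /E /D.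
elim: (X) d sd {so E D soX x0X F FE soE soF loF soloF soE0 allF} =>
  [|z Z IH] [|b d] //= [sd].
by rewrite inE; case: b => /=; rewrite ?inE ?negb_or; case: (eqVneq lo z) => //= _;
  apply: IH.
Qed.

(** The marks are recovered from the word: a letter is marked when it stands to the left of the
smallest one. *)
Definition valley_bits (v : seq nat) : bitseq :=
  [seq x \in take (index (head 0 (sort le v)) v) v | x <- behead (sort le v)].

Lemma le_total : total le.
Proof.
move=> x y; rewrite !le_r; case: (eqVneq x y) => [//|xy]; rewrite /=.
by case/orP: (r_total xy) => ->; rewrite ?orbT.
Qed.

Lemma sort_sorted_r v : uniq v -> sorted r (sort le v).
Proof.
rewrite -(sort_uniq le); have := sort_sorted le_total v.
case: (sort le v) => // x s; elim: s x => //= y s IH x /andP[xy so] /andP[xs us].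
rewrite IH // andbT; move: xy; rewrite le_r => /orP[/eqP e|//].
by rewrite e mem_head in xs.
Qed.

Lemma sort_r_id v X : sorted r X -> perm_eq v X -> sort le v = X.
Proof.
move=> so pe; apply: (irr_sorted_eq r_trans r_irr) => //.
  by apply: sort_sorted_r; rewrite (perm_uniq pe) (sorted_uniq r_trans r_irr so).
by move=> x; rewrite mem_sort (perm_mem pe).
Qed.

Lemma perm_valley_word X d : size d = (size X).-1 -> perm_eq (valley_word X d) X.
Proof.
case: X => //= x0 X sd; rewrite perm_catC /= perm_cons perm_catC.
apply: (@perm_trans _ (mask d X ++ mask (map negb d) X)).
  by rewrite perm_cat2r perm_rev.
elim: X d sd => [|x X IH] [|[] d] //= [sd]; first by rewrite perm_cons IH.
by rewrite perm_catC /= perm_cons perm_catC IH.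
Qed.

Lemma valley_bitsK X d : sorted r X -> size d = (size X).-1 ->
  valley_bits (valley_word X d) = d.
Proof.
move=> so sd; rewrite /valley_bits (sort_r_id so (perm_valley_word sd)).
have ux := sorted_uniq r_trans r_irr so.
case: X so sd ux => [|x0 X] /=; first by case: d.
move=> so sd /andP[x0X uX].
have x0n : x0 \notin rev (mask d X).
  by rewrite mem_rev; apply: contra x0X => /mem_mask.
rewrite index_cat (negPf x0n) /= eqxx addn0 take_size_cat //.
apply: (@eq_from_nth _ false); rewrite size_map // => i iX.
by rewrite (nth_map 0) // mem_rev in_mask // mem_nth //= index_uniq.
Qed.

Lemma no_peak_path s x : path r x s -> no_peak r (x :: s).
Proof.
elim: s x => //= y s IH x /andP[xy p]; rewrite (IH _ p) andbT.
by case: s p {IH} => //= z s /andP[yz _]; rewrite (r_asym yz) andbF.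
Qed.

Lemma path_no_peak s x y : uniq (x :: y :: s) -> no_peak r (x :: y :: s) -> r x y ->
  path r x (y :: s).
Proof.
elim: s x y => [|z s IH] x y /=; first by move=> _ _ ->.
move=> /and3P[_ ys us] /andP[h p] xy; rewrite xy /=; apply: IH => //=.
  by rewrite ys.
rewrite xy /= in h; have : y != z by move: ys; rewrite inE negb_or => /andP[].
by move/r_total; rewrite (negPf h) orbF.
Qed.

Lemma no_peak_desc l s x0 : sorted (fun a b => r b a) (rcons l x0) ->
  no_peak r (x0 :: s) -> no_peak r (l ++ x0 :: s).
Proof.
elim: l => //= x l IH so p; rewrite IH //; last first.
  by move: so; case: (l) => //= y l' /andP[].
rewrite andbT.
have : r (head 0 (l ++ x0 :: s)) x by case: (l) so => [|y l'] /= /andP[].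
by case: (l ++ x0 :: s) => //= y [|z w] // yx; rewrite (r_asym yx).
Qed.

Lemma no_peak_valley_word X d : sorted r X -> no_peak r (valley_word X d).
Proof.
case: X => // x0 X so; have := so; rewrite /= path_all => /andP[x0X soX].
apply: no_peak_desc; last first.
  apply: no_peak_path; rewrite path_all sorted_mask // andbT.
  by apply/allP => z /mem_mask /(allP x0X).
rewrite -rev_cons rev_sorted /= path_all sorted_mask // andbT.
by apply/allP => z /mem_mask /(allP x0X).
Qed.

Lemma valley_wordK v : uniq v -> no_peak r v ->
  v = valley_word (sort le v) (valley_bits v).
Proof.
move=> uv p; rewrite /valley_bits; have so := sort_sorted_r uv.
have me x : x \in sort le v = (x \in v) by rewrite mem_sort.
case E : (sort le v) so me => [|x0 X] so me.
  by case: v E {me uv p} => // x v E; have := size_sort le (x :: v); rewrite E.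
have x0v : x0 \in v by rewrite -me mem_head.
rewrite /=; have := so; rewrite /= path_all => /andP[x0X soX].
set a := take _ v; pose b := drop (index x0 v).+1 v.
have ve : v = a ++ x0 :: b.
  by rewrite /a /b -[in LHS](cat_take_drop (index x0 v) v) (drop_nth 0) ?index_mem //
    nth_index.
move: uv; rewrite ve cat_uniq => /and3P[ua /= ab /andP[x0b ub]].
have {ab}[x0a ab] : x0 \notin a /\ {in b, forall x, x \notin a}.
  move: ab; rewrite negb_or => /andP[-> /hasPn h]; split=> // x xb; exact: h.
have min x : x \in a ++ b -> r x0 x.
  move=> xab; apply: (allP x0X); have : x \in x0 :: X.
    rewrite me ve mem_cat inE orbCA -mem_cat; rewrite xab orbT //.
  rewrite inE => /orP[/eqP e|//]; move: xab; rewrite e mem_cat.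
  by rewrite (negPf x0a) (negPf x0b).
have asc w : uniq w -> no_peak r (x0 :: w) -> x0 \notin w -> {in w, forall x, r x0 x} ->
    sorted r w.
  case: w => // y w uw pw x0w mw; have : path r x0 (y :: w).
    by apply: path_no_peak => //; [rewrite cons_uniq x0w | apply: mw; exact: mem_head].
  by move=> /= /andP[].
have pfr l w : no_peak r (l ++ w) -> no_peak r w by elim: l => //= ? l IH /andP[_ /IH].
have sob : sorted r b.
  apply: asc => //; first by apply: (pfr a); rewrite -ve.
  by move=> x xb; apply: min; rewrite mem_cat xb orbT.
have soa : sorted r (rev a).
  apply: asc; rewrite ?rev_uniq ?mem_rev //.
    apply: (pfr (rev b)); rewrite -cat1s catA cats1 -rev_cons -rev_cat -ve.
    by rewrite no_peak_rev.
  by move=> x; rewrite mem_rev => xa; apply: min; rewrite mem_cat xa.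
have memX x : x \in X = (x \in a) || (x \in b).
  have := me x; rewrite ve mem_cat !inE; case: (eqVneq x x0) => [->|_] //= _.
  have /negPf -> : x0 \notin X.
    by apply/negP => /(allP x0X); rewrite r_irr.
  by rewrite (negPf x0a) (negPf x0b).
rewrite -map_comp -!filter_mask; congr (_ ++ _ :: _).
  rewrite -[LHS]revK; congr rev; apply: (irr_sorted_eq r_trans r_irr) => //.
    exact: sorted_filter.
  by move=> x; rewrite mem_rev mem_filter memX; case: (x \in a).
apply: (irr_sorted_eq r_trans r_irr) => //; first exact: sorted_filter.
move=> x; rewrite mem_filter memX /=.
by case: (boolP (x \in b)) => [/ab ->|] //; case: (x \in a).
Qed.

End Valley.

(** * Trading valley words for hill words *)

Lemma gtn_irr : irreflexive gtn.
Proof. by move=> x; rewrite /gtn /= ltnn. Qed.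
Lemma geq_eq_gtn x y : geq x y = (x == y) || gtn x y.
Proof. by rewrite /geq /gtn /= leq_eqVlt eq_sym. Qed.
Lemma gtn_connex x y : x != y -> gtn x y || gtn y x.
Proof. by rewrite /gtn /=; lia. Qed.
Lemma leq_eq_ltn x y : leq x y = (x == y) || ltn x y.
Proof. by rewrite /= leq_eqVlt. Qed.
Lemma ltn_connex x y : x != y -> ltn x y || ltn y x.
Proof. by rewrite /=; lia. Qed.

Lemma gaps_nth X d : size d = (size X).-1 ->
  gaps X d = [seq (nth 0 X i, nth 0 X i.+1, nth false d i) | i <- iota 0 (size d)].
Proof.
rewrite /gaps; case: X => [|x0 X]; first by case: d.
elim: X x0 d => [|x1 X IH] x0 [|b d] //= [sd]; congr (_ :: _).
have := IH x1 d sd; rewrite /= => ->.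
by rewrite -[1]addn0 iotaDl -map_comp; apply: eq_map => i.
Qed.

Lemma rev_iota n : rev (iota 0 n) = [seq n.-1 - i | i <- iota 0 n].
Proof.
apply: (@eq_from_nth _ 0); rewrite ?size_rev ?size_map // size_iota => i ni.
rewrite nth_rev ?size_iota // nth_iota; last by lia.
by rewrite (nth_map 0) ?size_iota // nth_iota // !add0n; lia.
Qed.

(** Reversing the order turns valley words into hill words and keeps the gaps, so
[valley_word_bound] and [valley_word_exists] apply to hill words as well. *)
Lemma count_free_gap_rev X d lo hi : size d = (size X).-1 ->
  count (free_gap geq hi lo) (gaps (rev X) (rev d)) =
    count (free_gap leq lo hi) (gaps X d).
Proof.
move=> sd; rewrite !gaps_nth ?size_rev // !count_map.
rewrite -[RHS]count_rev rev_iota count_map; apply: eq_in_count => i.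
rewrite mem_iota add0n => /= id; rewrite /free_gap /= !nth_rev; try lia.
have -> : size X - i.+1 = ((size d).-1 - i).+1 by lia.
have -> : size X - i.+2 = (size d).-1 - i by lia.
have -> : size d - i.+1 = (size d).-1 - i by lia.
by rewrite /geq /= [X in _ && X]andbC.
Qed.

(** Increasing subsequences of v can be replaced inside v', without leaving their range of
letters.  The range is what allows the replacement within a longer word. *)
Definition covers (v v' : seq nat) := forall y c, subseq (y :: c) v ->
  sorted ltn (y :: c) ->
  exists c', [/\ subseq c' v', sorted ltn c', size c' = (size c).+1 &
    all (fun z => y <= z <= last y c) c'].

Lemma last_ge y c : sorted ltn (y :: c) -> y <= last y c.
Proof.
elim: c y => //= z c IH y /andP[yz p]; exact: ltnW (leq_trans yz (IH z p)).
Qed.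

Lemma covers_valley_hill X d : sorted ltn X -> size d = (size X).-1 ->
  covers (valley_word X d) (hill_word X d).
Proof.
move=> so sd y c sc soc.
have memX z : z \in y :: c -> z \in X.
  by move/(mem_subseq sc); rewrite (perm_mem (perm_valley_word sd)).
have b := valley_word_bound ltn_trans ltnn leq_eq_ltn so sd sc soc.
have so' : sorted gtn (rev X) by rewrite rev_sorted.
have sd' : size (rev d) = (size (rev X)).-1 by rewrite !size_rev.
have lX : last y c \in rev X by rewrite mem_rev memX // mem_last.
have [c' [sc' soc' sz al]] :=
  valley_word_exists gtn_trans gtn_irr geq_eq_gtn so' sd' lX (last_ge soc).
rewrite count_free_gap_rev // in sz.
exists (rev (take (size c).+1 c')); split.
- by rewrite /hill_word subseq_rev; apply: subseq_trans (take_subseq _ _) sc'.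
- by rewrite rev_sorted; apply: subseq_sorted gtn_trans _ _ (take_subseq _ _) soc'.
- by rewrite size_rev size_takel // sz ltnS.
- rewrite all_rev; apply/allP => z /mem_take /(allP al).
  by rewrite /geq /= andbC.
Qed.

Lemma covers_hill_valley X d : sorted ltn X -> size d = (size X).-1 ->
  covers (hill_word X d) (valley_word X d).
Proof.
move=> so sd y c sc soc.
have so' : sorted gtn (rev X) by rewrite rev_sorted.
have sd' : size (rev d) = (size (rev X)).-1 by rewrite !size_rev.
have memX z : z \in y :: c -> z \in X.
  by move/(mem_subseq sc);
    rewrite /hill_word mem_rev (perm_mem (perm_valley_word sd')) mem_rev.
have yc : rev (y :: c) = last y c :: rev (belast y c) by rewrite lastI rev_rcons.
have sc2 : subseq (last y c :: rev (belast y c)) (valley_word (rev X) (rev d)).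
  by rewrite -yc -[valley_word _ _]revK subseq_rev.
have soc2 : sorted gtn (last y c :: rev (belast y c)) by rewrite -yc rev_sorted.
have b := valley_word_bound gtn_trans gtn_irr geq_eq_gtn so' sd' sc2 soc2.
have lasty : last (last y c) (rev (belast y c)) = y.
  by case: (c) => //= z c0; rewrite rev_cons last_rcons.
rewrite lasty count_free_gap_rev // size_rev size_belast in b.
have [c' [sc' soc' sz al]] :=
  valley_word_exists ltn_trans ltnn leq_eq_ltn so sd (memX y (mem_head _ _)) (last_ge
    soc).
exists (take (size c).+1 c'); split.
- by apply: subseq_trans (take_subseq _ _) sc'.
- by apply: subseq_sorted ltn_trans _ _ (take_subseq _ _) soc'.
- by rewrite size_takel // sz ltnS.
- by apply/allP => z /mem_take /(allP al).
Qed.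

Definition has_increasing (k : nat) (t : seq nat) : Prop :=
  exists u, [/\ subseq u t, sorted ltn u & size u = k].

Lemma covers_has_increasing k p v v' q : covers v v' ->
  has_increasing k (p ++ v ++ q) -> has_increasing k (p ++ v' ++ q).
Proof.
move=> cv [u [/subseq_catP[u1 [u2 [-> s1 /subseq_catP[c [u3 [-> sc s3]]]]]] so sz]].
case: c sc so sz => [|y c] sc so sz.
  exists (u1 ++ u3); split=> //; last first.
  by apply: cat_subseq => //; apply: subseq_trans s3 (suffix_subseq _ _).
have soc : sorted ltn (y :: c).
  have := so; rewrite !(sorted_pairwise ltn_trans) !pairwise_cat.
  by case/and3P => _ _ /and3P[].
have [c' [sc' soc' szc al]] := cv _ _ sc soc.
exists (u1 ++ c' ++ u3); split; first by rewrite !cat_subseq.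
  have yl := last_ge soc; move: so soc'.
  rewrite !(sorted_pairwise ltn_trans) !pairwise_cat !allrel_catr.
  case/and3P => /andP[a1 a2] p1 /and3P[a3 p2 p3] pc'.
  rewrite p1 p3 pc' a2 !andbT; apply/andP; split.
    apply/allrelP => x z xu /(allP al) /andP[yz _].
    by apply: leq_trans yz; apply: (allrelP a1) => //; exact: mem_head.
  apply/allrelP => z x /(allP al) /andP[_ zl] xu.
  by apply: leq_ltn_trans zl _; apply: (allrelP a3) => //; exact: mem_last.
by rewrite -sz !size_cat szc.
Qed.

Definition to_hill (v : seq nat) : seq nat := hill_word (sort leq v) (valley_bits leq v).
Definition to_valley (u : seq nat) : seq nat :=
  valley_word (sort leq u) (rev (valley_bits geq (rev u))).

Lemma size_valley_bits le v : size (valley_bits le v) = (size v).-1.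
Proof. by rewrite /valley_bits size_map size_behead size_sort. Qed.

Lemma sort_ltn v : uniq v -> sorted ltn (sort leq v).
Proof. by rewrite ltn_sorted_uniq_leq sort_uniq => ->; rewrite sort_sorted //;
  exact: leq_total. Qed.

Lemma sort_geq_rev v : uniq v -> sort geq (rev v) = rev (sort leq v).
Proof.
move=> uv; apply: (sort_r_id gtn_trans gtn_irr geq_eq_gtn gtn_connex).
  by rewrite rev_sorted sort_ltn.
by rewrite perm_rev perm_sym perm_rev perm_sort.
Qed.

Section ToHill.
Variable v : seq nat.
Hypothesis uv : uniq v.

Let so : sorted ltn (sort leq v) := sort_ltn uv.

Lemma perm_hill_word X d : size d = (size X).-1 -> perm_eq (hill_word X d) X.
Proof.
move=> sd; rewrite /hill_word perm_rev perm_sym -perm_rev perm_sym.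
by apply: perm_valley_word; rewrite !size_rev.
Qed.

Lemma perm_to_hill : perm_eq (to_hill v) v.
Proof. by apply: perm_trans (perm_hill_word _) _;
  rewrite ?size_valley_bits ?size_sort // perm_sort. Qed.

Lemma perm_to_valley : perm_eq (to_valley v) v.
Proof.
apply: perm_trans (perm_valley_word _) _;
  rewrite ?size_rev ?size_valley_bits ?size_sort ?size_rev //.
by rewrite perm_sort.
Qed.

Lemma no_valley_to_hill : no_peak gtn (to_hill v).
Proof. by rewrite no_peak_rev; apply: (no_peak_valley_word gtn_trans gtn_irr);
  rewrite rev_sorted. Qed.

Lemma no_peak_to_valley : no_peak ltn (to_valley v).
Proof. exact: (no_peak_valley_word ltn_trans ltnn). Qed.

Lemma to_hillK : no_peak ltn v -> to_valley (to_hill v) = v.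
Proof.
move=> p; have sd : size (valley_bits leq v) =
  (size (sort leq v)).-1 by rewrite size_valley_bits size_sort.
have e := sort_r_id ltn_trans ltnn leq_eq_ltn ltn_connex so (perm_hill_word sd).
rewrite /to_valley /to_hill e /hill_word revK.
rewrite (valley_bitsK gtn_trans gtn_irr geq_eq_gtn gtn_connex) ?rev_sorted ?size_rev //
  revK.
by rewrite -(valley_wordK ltn_trans ltnn leq_eq_ltn ltn_connex).
Qed.

Lemma to_valleyK : no_peak gtn v -> to_hill (to_valley v) = v.
Proof.
move=> p; have sd : size (rev (valley_bits geq (rev v))) = (size (sort leq v)).-1.
  by rewrite size_rev size_valley_bits size_sort size_rev.
have e := sort_r_id ltn_trans ltnn leq_eq_ltn ltn_connex so (perm_valley_word sd).
rewrite /to_hill /to_valley e (valley_bitsK ltn_trans ltnn leq_eq_ltn ltn_connex) //.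
rewrite /hill_word revK -sort_geq_rev //.
by rewrite -(valley_wordK gtn_trans gtn_irr geq_eq_gtn gtn_connex) ?revK ?rev_uniq
  ?no_peak_rev.
Qed.

Lemma covers_to_hill : no_peak ltn v -> covers v (to_hill v) /\ covers (to_hill v) v.
Proof.
move=> p; have sd : size (valley_bits leq v) =
  (size (sort leq v)).-1 by rewrite size_valley_bits size_sort.
rewrite {1 4}(valley_wordK ltn_trans ltnn leq_eq_ltn ltn_connex uv p).
by split; [apply: covers_valley_hill | apply: covers_hill_valley].
Qed.

End ToHill.

(** * Cutting a filling into blocks *)

(** The lengths of the blocks, where the bit i of g glues the positions i and i.+1 together. *)
Fixpoint seg_sizes (g : seq bool) (n : nat) : seq nat :=
  if n is n'.+1 then
    let s := seg_sizes (behead g) n' in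
    if head false g then (head 0 s).+1 :: behead s else 1 :: s
  else [::].

Lemma sumn_seg_sizes g n : sumn (seg_sizes g n) = n.
Proof.
elim: n g => //= n IH g; have := IH (behead g).
by case: ifP => _; case: (seg_sizes _ _) => [|a s] /=; lia.
Qed.

Definition segs (T : Type) (g : seq bool) (t : seq T) := reshape (seg_sizes g (size t)) t.

Lemma segs_cons (T : Type) g x (t : seq T) : segs g (x :: t) =
  if head false g then (x :: head [::] (segs (behead g) t)) :: behead (segs (behead g) t)
  else [:: x] :: segs (behead g) t.
Proof.
rewrite /segs /=; case: ifP => _ /=; last by rewrite take0 drop0.
by case: (seg_sizes _ _) => [|a s] /=; rewrite ?take0.
Qed.

Lemma flatten_segs (T : Type) g (t : seq T) : flatten (segs g t) = t.
Proof. by rewrite reshapeKr // sumn_seg_sizes. Qed.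

Lemma head_segs (T : Type) g (t : seq T) :
  head [::] (segs g t) =
  match t with
  | [::] => [::]
  | x :: t' => x :: if head false g then head [::] (segs (behead g) t') else [::]
  end.
Proof. by case: t => // x t; rewrite segs_cons; case: ifP. Qed.

Lemma all_no_peak_segs r g t : reflect
  (forall i, i.+2 < size t -> nth false g i -> nth false g i.+1 ->
    ~~ (r (nth 0 t i) (nth 0 t i.+1) && r (nth 0 t i.+2) (nth 0 t i.+1)))
  (all (no_peak r) (segs g t)).
Proof.
elim: t g => [|x t IH] g; first by left.
have all_hd (s : seq (seq nat)) : all (no_peak r) s = no_peak r (head [::] s) &&
  all (no_peak r) (behead s).
  by case: s.
have nb i : nth false (behead g) i = nth false g i.+1 by case: g; rewrite ?nth_nil.
have n0 : nth false g 0 = head false g by rewrite nth0.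
apply: (iffP idP) => [|h].
  rewrite segs_cons => h.
  have tl : all (no_peak r) (segs (behead g) t).
    move: h; case: ifP => _ /=; last by []. move=> /andP[h1 h2].
    by rewrite all_hd h2 andbT; case/andP: h1.
  case=> [|i] it /=; last first.
    by rewrite -!nb; move/IH: tl; apply.
  rewrite n0 -nb => g0 g1; move: h; rewrite g0 /= head_segs.
  case: t it {IH tl} => [|y [|z t]] //= _.
  by rewrite nth0 in g1; rewrite head_segs g1 /= => /andP[/andP[->]].
rewrite segs_cons.
have tl : all (no_peak r) (segs (behead g) t).
  by apply/IH => i it gi gi1; apply: (h i.+1) => //; rewrite -nb.
case: ifP => g0 /=; last by [].
move: tl; rewrite all_hd => /andP[-> ->]; rewrite !andbT.
rewrite head_segs; case: t h {IH} => // y t h; case: ifP => // g1.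
rewrite head_segs; case: t h => // z t h.
by apply: (h 0); rewrite -?nb ?nth0.
Qed.

(** Apply f to each block. *)
Definition blockmap (f : seq nat -> seq nat) (g : seq bool) (t : seq nat) : seq nat :=
  flatten (map f (segs g t)).

Section BlockMap.
Variable f : seq nat -> seq nat.
Hypothesis perm_f : forall v, perm_eq (f v) v.

Lemma perm_blockmap g t : perm_eq (blockmap f g t) t.
Proof.
rewrite /blockmap -{2}(flatten_segs g t); elim: (segs g t) => //= s ss IH.
exact: perm_cat.
Qed.

Lemma shape_map_f ss : shape (map f ss) = shape ss.
Proof. by rewrite /shape -map_comp; apply: eq_map => s /=; exact: perm_size. Qed.

Lemma segs_blockmap g t : segs g (blockmap f g t) = map f (segs g t).
Proof.
rewrite {1}/segs (perm_size (perm_blockmap g t)) /blockmap.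
rewrite -[X in reshape X](_ : shape (map f (segs g t)) = _) ?flattenK //.
by rewrite shape_map_f /segs reshapeKl // sumn_seg_sizes.
Qed.

Lemma fills_blockmap hs g t : (forall i, i.+1 < size hs -> nth false g i ->
  nth 0 hs i = nth 0 hs i.+1) -> fills hs t -> fills hs (blockmap f g t).
Proof.
move=> hg /and3P[/eqP st ut at_].
have pe := perm_blockmap g t.
apply/and3P; split; rewrite ?(perm_size pe) ?st ?(perm_uniq pe) //.
have: all (fun s => constant s) (segs g hs).
  elim: hs g hg {t st ut at_ pe} => // h hs IH g hg.
  have := IH (behead g); rewrite segs_cons.
  have h1 i : i.+1 < size hs -> nth false (behead g) i -> nth 0 hs i = nth 0 hs i.+1.
    by move=> ih gi; apply: (hg i.+1) => //; move: gi; case: (g) => [|b g1] //=;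
      rewrite nth_nil.
  move=> /(_ h1); case: ifP => // g0.
  case E : (segs (behead g) hs) => [|s ss] //= /andP[cs ->]; rewrite andbT.
  have := head_segs (behead g) hs; rewrite E /=.
  case: hs hg {IH h1 E} => [hg -> //|h2 hs hg es].
  have e2 : h = h2 by apply: (hg 0) => //; case: (g) g0.
  by move: cs; rewrite es e2 /= eqxx.
have := sumn_seg_sizes g (size hs); rewrite /blockmap /segs st.
move: (seg_sizes g (size hs)) => al;
  elim: al t hs st at_ {hg ut pe} => [|a al IH] t hs st at_ /= sm.
  by move/eqP: (esym sm); rewrite size_eq0 => /eqP ->.
case/andP => ca cal; set c := head 0 hs.
have sa : a <= size hs by rewrite -sm leq_addr.
have ha : take a hs = nseq a c.
  rewrite -[in RHS](size_takel sa) /c.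
  by case: (a) (hs) ca => [|a'] [|x hs'] //= /all_pred1P {1}->.
have all2c v w1 w2 : size v = a ->
    all2 ltn (v ++ w1) (nseq a c ++ w2) = all (fun x => x < c) v && all2 ltn w1 w2.
  by move=> <-; elim: v => //= x v ->; rewrite andbA.
have sta : size (take a t) = a by rewrite size_takel ?st.
rewrite -(cat_take_drop a hs) ha.
move: at_; rewrite -{1}(cat_take_drop a hs) ha -{1}(cat_take_drop a t).
rewrite all2c // => /andP[at1 at2].
rewrite all2c ?(perm_size (perm_f _)) // (perm_all _ (perm_f _)) at1 /=; apply: IH => //.
  by rewrite !size_drop st.
by rewrite size_drop -sm addKn.
Qed.

End BlockMap.

Lemma uniq_segs g (t : seq nat) : uniq t -> all uniq (segs g t).
Proof.
rewrite -{1}(flatten_segs g t); elim: (segs g t) => //= s ss IH.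
by rewrite cat_uniq => /and3P[-> _ /IH].
Qed.

Lemma blockmap_id f f' g t (P : pred (seq nat)) : (forall v, perm_eq (f v) v) ->
  {in [pred v | uniq v && P v], cancel f f'} ->
  uniq t -> all P (segs g t) -> blockmap f' g (blockmap f g t) = t.
Proof.
move=> fp fK /(uniq_segs g) us ps; rewrite {1}/blockmap segs_blockmap //.
rewrite -[RHS](flatten_segs g t); congr flatten.
elim: (segs g t) us ps => //= s ss IH /andP[us uss] /andP[ps pss].
by rewrite IH // fK // inE us ps.
Qed.

Lemma has_increasing_blockmap k g t : uniq t -> all (no_peak ltn) (segs g t) ->
  has_increasing k t <-> has_increasing k (blockmap to_hill g t).
Proof.
move=> /(uniq_segs g) us ps; rewrite -{1}(flatten_segs g t) /blockmap.
(* The blocks are replaced from left to right; p collects those already replaced. *)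
suff H p ss : all uniq ss -> all (no_peak ltn) ss ->
    has_increasing k (p ++ flatten ss) <->
      has_increasing k (p ++ flatten (map to_hill ss)) by exact: (H [::]).
elim: ss p => //= s ss IH p /andP[us' uss] /andP[ps' pss].
have [c1 c2] := covers_to_hill us' ps'.
have e := IH (p ++ to_hill s) uss pss; rewrite -!catA in e; rewrite -e.
by split; apply: covers_has_increasing.
Qed.

(** The last letter of an increasing chain lies in the lowest row and the last column of the
chain, so the chain fits into the diagram. *)
Lemma has_increasingP k hs t : sorted geq hs -> fills hs t -> 0 < k ->
  reflect (has_increasing k t) (has_chain ltn k hs t).
Proof.
move=> so /and3P[/eqP st ut at_] k0; apply: (iffP hasP).
  move=> [c _ /chainP[u [su sou sz _]]]; exists u; split=> //.
  exact: subseq_trans su (take_subseq _ _).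
move=> [u [su sou sz]]; case/lastP: u sz su sou => [|u x] sz su sou.
  by rewrite -sz in k0.
have xt : x \in t by apply: (mem_subseq su); rewrite mem_rcons mem_head.
exists (index x t); first by rewrite mem_iota /= add0n index_mem.
apply/chainP; exists (rcons u x); split=> //.
  have : uniq (rcons (take (index x t) t) x ++ drop (index x t).+1 t).
    by rewrite cat_rcons -{2}(nth_index 0 xt) -drop_nth ?index_mem // cat_take_drop.
  rewrite cat_uniq => /and3P[_ /hasPn h _].
  have xd : x \notin drop (index x t).+1 t.
    by apply/negP => /h; rewrite mem_rcons mem_head.
  move: su; rewrite -{1}(cat_take_drop (index x t).+1 t) =>
    /subseq_catP[u1 [u2 [e s1 s2]]].
  case/lastP: u2 e s2 => [|u2 y]; first by rewrite cats0 => ->.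
  rewrite -rcons_cat => /rcons_inj[_ <-] s2; case/negP: xd.
  by apply: (mem_subseq s2); rewrite mem_rcons mem_head.
have xh : x < nth 0 hs (index x t).
  rewrite -{1}(nth_index 0 xt).
  have : index x t < size t by rewrite index_mem.
  by elim: (t) (hs) (index x t) at_ => [|y t' IH] [|h hs'] [|i] //= /andP[] // yh a ii;
    apply: IH.
rewrite all_rcons xh /=; move: sou; rewrite sorted_rconsE; last exact: ltn_trans.
by move=> /andP[_]; apply: sub_all => z /= zx; apply: ltn_trans zx xh.
Qed.

Lemma count_le_inj (T : eqType) (L : seq T) (P Q : pred T) (f : T -> T) : uniq L ->
  {in L, forall t, P t -> (f t \in L) && Q (f t)} ->
  {in [pred t in L | P t] &, injective f} -> count P L <= count Q L.
Proof.
move=> uL fPQ finj; rewrite -!size_filter -(size_map f); apply: uniq_leq_size.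
  rewrite map_inj_in_uniq ?filter_uniq // => x y.
  by rewrite !mem_filter => /andP[? ?] /andP[? ?]; apply: finj; rewrite inE; apply/andP.
move=> y /mapP[x]; rewrite mem_filter => /andP[px xL] ->.
by rewrite mem_filter andbC fPQ.
Qed.

Section Counts.
Variables (hs Rs : seq nat) (k : nat) (g : seq bool).
Hypothesis hs_sorted : sorted geq hs.
Hypothesis k_gt0 : 0 < k.
Hypothesis g_level : forall i, i.+1 < size hs -> nth false g i ->
  nth 0 hs i = nth 0 hs i.+1.

Let L := permutations Rs.
Let cond (r r' : rel nat) (t : seq nat) :=
  [&& fills hs t, ~~ has_chain r k hs t & all (no_peak r') (segs g t)].

Lemma mem_permutations_perm t t' : perm_eq t' t -> t \in L -> t' \in L.
Proof. by rewrite !mem_permutations; exact: perm_trans. Qed.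

(** The blocks are replaced by hill words, which preserves the increasing chains. *)
Lemma count_valley : count (cond ltn ltn) L = count (cond ltn gtn) L.
Proof.
have pfp t := @perm_to_hill t; have pfp' t := @perm_to_valley t.
have ps'K : {in [pred v | uniq v && no_peak gtn v], cancel to_valley to_hill}.
  by move=> v /andP[u p]; exact: to_valleyK.
have psK : {in [pred v | uniq v && no_peak ltn v], cancel to_hill to_valley}.
  by move=> v /andP[u p]; exact: to_hillK.
apply/eqP; rewrite eqn_leq; apply/andP; split.
  apply: (count_le_inj (f := blockmap to_hill g)); first exact: permutations_uniq.
    move=> t tL /and3P[wt nt pt];
      rewrite (mem_permutations_perm (perm_blockmap pfp _ _) tL) /=.
    have wt' := fills_blockmap pfp g_level wt.
    have /and3P[_ ut _] := wt; apply/and3P; split=> //.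
      apply/(has_increasingP hs_sorted wt' k_gt0) =>
        /(has_increasing_blockmap _ ut pt) /(has_increasingP hs_sorted wt k_gt0).
      exact/negP.
    rewrite segs_blockmap // all_map; apply/allP => s /(allP (uniq_segs g ut)).
    exact: no_valley_to_hill.
  apply: (can_in_inj (g := blockmap to_valley g)) => t.
  by rewrite inE => /andP[_ /and3P[/and3P[_ ut _] _ pt]]; apply: blockmap_id psK ut pt.
apply: (count_le_inj (f := blockmap to_valley g)); first exact: permutations_uniq.
  move=> t tL /and3P[wt nt pt];
    rewrite (mem_permutations_perm (perm_blockmap pfp' _ _) tL) /=.
  have wt' := fills_blockmap pfp' g_level wt.
  have /and3P[_ ut _] := wt; have /and3P[_ ut' _] := wt'.
  have pt' : all (no_peak ltn) (segs g (blockmap to_valley g t)).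
    rewrite segs_blockmap // all_map; apply/allP => s /(allP (uniq_segs g ut)).
    exact: no_peak_to_valley.
  apply/and3P; split=> //.
  apply/(has_increasingP hs_sorted wt' k_gt0) => /(has_increasing_blockmap _ ut' pt').
  by rewrite (blockmap_id pfp' ps'K ut pt) => /(has_increasingP hs_sorted wt k_gt0);
    exact/negP.
apply: (can_in_inj (g := blockmap to_hill g)) => t.
by rewrite inE => /andP[_ /and3P[/and3P[_ ut _] _ pt]]; apply: blockmap_id ps'K ut pt.
Qed.

Lemma flip_no_peak t : fills hs t ->
  all (no_peak ltn) (segs g (flip hs t)) = all (no_peak gtn) (segs g t).
Proof.
move=> wt; have /and3P[/eqP st ut _] := wt.
have wf := fills_flip hs_sorted wt; have /and3P[/eqP sf uf _] := wf.
have A i : i.+1 < size hs -> nth false g i ->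
    (nth 0 (flip hs t) i.+1 < nth 0 (flip hs t) i) = (nth 0 t i < nth 0 t i.+1).
  by move=> ih gi; apply: flip_asc => //; exact: g_level.
have A' i : i.+1 < size hs -> nth false g i ->
    (nth 0 (flip hs t) i < nth 0 (flip hs t) i.+1) = (nth 0 t i.+1 < nth 0 t i).
  move=> ih gi; have := A i ih gi.
  have : nth 0 t i != nth 0 t i.+1 by rewrite nth_uniq ?st //; lia.
  have : nth 0 (flip hs t) i != nth 0 (flip hs t) i.+1 by rewrite nth_uniq ?sf //; lia.
  by lia.
apply/all_no_peak_segs/all_no_peak_segs => h i; rewrite ?st ?sf => it gi gi1.
  by have := h i; rewrite sf /gtn /= => /(_ it gi gi1); rewrite A' ?A //; lia.
by have := h i; rewrite st /gtn /= => /(_ it gi gi1); rewrite A' ?A //; lia.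
Qed.

Lemma count_flip : count (cond ltn gtn) L = count (cond gtn ltn) L.
Proof.
apply/eqP; rewrite eqn_leq; apply/andP; split;
  apply: (count_le_inj (f := flip hs)); try exact: permutations_uniq.
- move=> t tL /and3P[wt nt pt];
  rewrite (mem_permutations_perm (perm_flip hs_sorted wt) tL).
  by rewrite /cond fills_flip // flip_chain // nt flip_no_peak.
- apply: (can_in_inj (g := flip hs)) => t.
  by rewrite inE => /andP[_ /and3P[wt _ _]]; apply: flipK.
- move=> t tL /and3P[wt nt pt];
  rewrite (mem_permutations_perm (perm_flip hs_sorted wt) tL).
  have wf := fills_flip hs_sorted wt.
  by rewrite /cond wf -flip_chain // flipK // nt -flip_no_peak // flipK.
- apply: (can_in_inj (g := flip hs)) => t.
  by rewrite inE => /andP[_ /and3P[wt _ _]]; apply: flipK.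
Qed.

Lemma count_blocks : count (cond ltn ltn) L = count (cond gtn ltn) L.
Proof. by rewrite count_valley count_flip. Qed.

End Counts.

(** * Sets without two consecutive elements *)

Import GRing.Theory.

Section Sparse.
Variable n : nat.
Implicit Types M K S : {set 'I_n}.

Definition sparse M := [forall i in M, forall j in M, j != i.+1 :> nat].
Definition mem_nat M (i : nat) := i \in [seq val j | j in M].

(** The set M together with the single positions between two elements of M. *)
Definition patch M : {set 'I_n} :=
  [set i : 'I_n | (i \in M) || (mem_nat M i.-1 && (0 < i) && mem_nat M i.+1)].

Lemma mem_natP M (i : nat) : reflect (exists2 j : 'I_n, j \in M & i = j) (mem_nat M i).
Proof.
by apply: (iffP imageP) => -[j jM ->]; exists j.
Qed.

Lemma mem_natE M (i : 'I_n) : mem_nat M i = (i \in M).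
Proof. by apply/mem_natP/idP => [[j jM /val_inj ->]|iM] //; exists i. Qed.

Lemma sparseP M : reflect (forall i j, i \in M -> j \in M -> j <> i.+1 :> nat) (sparse M).
Proof.
apply: (iffP idP) => [/forall_inP h i j iM jM|h].
  by apply/eqP; have /forall_inP := h i iM; apply.
apply/forall_inP => i iM; apply/forall_inP => j jM; apply/eqP; exact: h.
Qed.

(** Move each element of M that is outside K down to its predecessor in K.  As M is sparse, this
is injective.  If it were onto, the successor of the largest element of M outside K would be
hit, either by itself, which is excluded by sparseness, or by a larger element outside K.
So M would be contained in K, hence equal to it. *)
Lemma card_sparse_patch M K : sparse M -> M \subset patch K -> M != K -> #|M| < #|K|.
Proof.
move=> /sparseP sM /subsetP MK MnK.
pose f i := if i \in K then i else odflt i [pick j in K | j.+1 == i :> nat].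
have fP i : i \in M -> (i \in K /\ f i = i) \/
    [/\ i \notin K, f i \in K, i = (f i).+1 :> nat & mem_nat K i.+1].
  rewrite /f; case: (boolP (i \in K)) => [iK _|iK /MK]; first by left.
  rewrite inE (negPf iK) /= => /andP[/andP[/mem_natP[j jK ej] i0] ip]; right.
  case: pickP => [j' /andP[j'K /eqP e]|/(_ j)]; first by split=> //=; exact: esym.
  by rewrite /= jK /= -ej prednK // eqxx.
have finj : {in M &, injective f}.
  move=> i j iM jM e; apply: val_inj => /=.
  have sij := sM _ _ iM jM; have sji := sM _ _ jM iM.
  case: (fP i iM) => [[_ ei]|[_ _ ei _]]; case: (fP j jM) => [[_ ej]|[_ _ ej _]].
  - by rewrite -ei e ej.
  - by case: sij; rewrite ej -e ei.
  - by case: sji; rewrite ei e ej.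
  - by rewrite ei e -ej.
have fK : f @: M \subset K.
  apply/subsetP => _ /imsetP[i iM ->].
  by case: (fP i iM) => [[iK ->]|[]].
have cM : #|f @: M| = #|M| by exact: card_in_imset.
rewrite ltn_neqAle -{2}cM subset_leq_card // andbT.
apply: contra MnK => /eqP eMK.
have efK : f @: M = K by apply/eqP; rewrite eqEcard fK cM eMK leqnn.
rewrite eqEcard eMK leqnn andbT.
apply/subsetP => i0 i0M; case: (fP i0 i0M) => [[//]|[i0K _ _ _]].
have [i /andP[iM iK] imax] :=
  @arg_maxnP _ i0 (fun i => (i \in M) && (i \notin K)) val ltac:(by rewrite /= i0M i0K).
case: (fP i iM) => [[iK' _]|[_ _ _ /mem_natP[j jK ej]]]; first by rewrite iK' in iK.
move: jK; rewrite -efK => /imsetP[j' j'M ej'].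
case: (fP j' j'M) => [[_ e]|[j'K _ e _]].
  by case: (sM i j' iM j'M); rewrite -e -ej' ej.
have le : (nat_of_ord j' <= nat_of_ord i)%N by apply: imax; rewrite j'M j'K.
by move: le e ej; rewrite -ej'; lia.
Qed.

Local Open Scope ring_scope.

(** Expand the product of -1 + 1 over B. *)
Lemma alt_sum (B : {set 'I_n}) :
  \sum_(M : {set 'I_n} | M \subset B) (-1) ^+ #|M| = (B == set0)%:R :> int.
Proof.
pose F (i : 'I_n) : int := if i \in B then -1 else 0.
have := bigA_distr 1 +%R F (fun=> 1); rewrite (_ : \prod_i _ = (B == set0)%:R).
  move=> ->; rewrite big_mkcond /=; apply: eq_bigr => M _.
  case: ifP => [/subsetP MB|/negbT/subsetPn[i iM iB]].
    rewrite -big_mkcond /= (eq_bigr (fun=> -1)) ?prodr_const // => i iM.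
    by rewrite /F MB.
  by rewrite (bigD1 i) //= iM /F (negPf iB) mul0r.
case: (set_0Vmem B) => [e|[i iB]].
  by rewrite e eqxx big1 // => i _; rewrite /F e inE /= add0r.
have /negPf -> : B != set0 by apply/set0Pn; exists i.
by rewrite (bigD1 i) //= /F iB /= addNr mul0r.
Qed.

(** The numbers g K of the members that contain K vanish by induction on #|K|: inclusion and
exclusion expresses the sum over the sets that avoid [patch K] by the values of g on the
subsets of [patch K], and of these only K itself is sparse with #|K| elements or more.  The
values of d follow from those of g by induction on the complement. *)
Lemma sparse_determined (d : {set 'I_n} -> int) (ok : pred {set 'I_n}) :
  (forall M, ok M -> sparse M) ->
  (forall M K, M \subset K -> ok K -> ok M) ->
  (forall M, ~~ ok M -> d M = 0) ->
  (forall K, ok K -> \sum_(M : {set 'I_n} | [disjoint M & patch K]) d M = 0) ->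
  forall M, d M = 0.
Proof.
move=> ok_sparse ok_sub dn0 de.
pose g (K : {set 'I_n}) := \sum_(M : {set 'I_n} | K \subset M) d M.
have gn0 K : ~~ ok K -> g K = 0.
  move=> nK; rewrite /g big1 // => M KM; apply: dn0.
  by apply: contra nK; exact: ok_sub.
have eg S : \sum_(M : {set 'I_n} | [disjoint M & S]) d M =
    \sum_(K : {set 'I_n} | K \subset S) (-1) ^+ #|K| * g K.
  under [RHS]eq_bigr do rewrite /g big_distrr /=.
  rewrite (exchange_big_dep xpredT) //= [LHS]big_mkcond; apply: eq_bigr => M _.
  rewrite -big_distrl /=.
  under eq_bigl do rewrite -subsetI.
  rewrite alt_sum -setI_eq0 setIC; case: (_ == _); first by rewrite mul1r.
  by rewrite mul0r.
have g0 K : g K = 0.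
  have [m] := ubnP #|K|; elim: m K => // m IH K; rewrite ltnS => Km.
  case: (boolP (ok K)) => [okK|]; last exact: gn0.
  have := eg (patch K); rewrite de // (bigD1 K) /=; last first.
    by apply/subsetP => i iK; rewrite inE iK.
  rewrite big1 ?addr0 => [/esym/eqP|M /andP[MK neMK]].
    by rewrite mulf_eq0 expf_eq0 oppr_eq0 oner_eq0 andbF /= => /eqP.
  case: (boolP (ok M)) => [okM|/gn0 ->]; last by rewrite mulr0.
  rewrite IH ?mulr0 //; apply: leq_trans Km.
  by apply: card_sparse_patch => //; exact: ok_sparse.
move=> K; have [m] := ubnP (n - #|K|)%N; elim: m K => // m IH K; rewrite ltnS => Km.
have := g0 K; rewrite /g (bigD1 K) //= big1 ?addr0 // => M /andP[KM neMK].
apply: IH; have : K \proper M by rewrite properEneq eq_sym neMK.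
move/proper_card => c.
have c2 : (#|M| <= n)%N by rewrite -[X in (_ <= X)%N]card_ord max_card.
by apply: leq_trans Km; lia.
Qed.

End Sparse.

(** * Equidistribution for increasing and decreasing chains *)

Definition level (hs : seq nat) (i : nat) : bool :=
  [&& 0 < i, i.+1 < size hs, nth 0 hs i.-1 == nth 0 hs i & nth 0 hs i == nth 0 hs i.+1].

Definition peaks (hs t : seq nat) : {set 'I_(size hs)} :=
  [set i : 'I_(size hs) | [&& level hs i,
    nth 0 t i.-1 < nth 0 t i & nth 0 t i.+1 < nth 0 t i]].

Section Core.
Variables (hs Rs : seq nat) (k : nat).
Hypothesis hs_sorted : sorted geq hs.
Hypothesis k_gt0 : 0 < k.

Let n := size hs.
Let L := permutations Rs.
Let avo (r : rel nat) (t : seq nat) := fills hs t && ~~ has_chain r k hs t.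

Definition peak_like (K : {set 'I_n}) := sparse K && [forall i in K, level hs i].

Lemma peaks_peak_like t : peak_like (peaks hs t).
Proof.
apply/andP; split; last by apply/forall_inP => i; rewrite inE => /andP[].
apply/sparseP => i j; rewrite !inE => /and3P[_ _ h1] /and3P[_ h2 _] e.
by move: h1 h2; rewrite e /= => /ltn_trans h /h; rewrite ltnn.
Qed.

(** The blocks join each element of K with its two neighbours. *)
Definition glue (K : {set 'I_n}) : seq bool :=
  [seq mem_nat K i || mem_nat K i.+1 | i <- iota 0 n].

Lemma nth_glue K i : nth false (glue K) i = (i < n) && (mem_nat K i || mem_nat K i.+1).
Proof.
case: (ltnP i n) => ni; last by rewrite nth_default // size_map size_iota.
by rewrite (nth_map 0) ?size_iota // nth_iota.
Qed.

Lemma peak_like_level K i : peak_like K -> mem_nat K i -> level hs i.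
Proof. by move=> /andP[_ /forall_inP h] /mem_natP[j jK ->]; exact: h. Qed.

Lemma glue_level K : peak_like K -> forall i, i.+1 < size hs -> nth false (glue K) i ->
  nth 0 hs i = nth 0 hs i.+1.
Proof.
move=> plK i ih; rewrite nth_glue => /andP[_ /orP[]] /(peak_like_level plK) /and4P[_ _].
  by move=> _ /eqP.
by move=> /eqP.
Qed.

(** A position is interior to a block when it is in K or both of its neighbours are. *)
Lemma disjoint_patch K t : peak_like K -> size t = n ->
  [disjoint peaks hs t & patch K] = all (no_peak ltn) (segs (glue K) t).
Proof.
move=> plK st; have gl := glue_level plK.
apply/idP/all_no_peak_segs => [dis i|h].
  rewrite st => it g0 g1; apply/negP => pk.
  have i1n : i.+1 < n by exact: ltnW.
  have : Ordinal i1n \in peaks hs t.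
    by rewrite inE /level /= pk andbT (gl i i1n g0) (gl i.+1 it g1) !eqxx it.
  move/(disjointFr dis); rewrite inE /= => /negbT; rewrite -mem_natE /=.
  by move: g0 g1; rewrite !nth_glue; case: (mem_nat _ i.+1) => //=;
    rewrite !orbF => /andP[_ ->] /andP[_ ->].
apply/pred0P => i /=; apply/negP => /andP[]; rewrite inE => /andP[/and4P[i0 it _ _] pk].
rewrite inE => fi; have := h i.-1; rewrite prednK // st => /(_ it).
rewrite pk !nth_glue prednK //= => H; have := ltn_ord i; rewrite -/n => iN.
suff : false by []; apply: H.
  rewrite (ltnW iN) mem_natE.
  by case/orP: fi => [->|/andP[/andP[-> _] _]]; rewrite ?orbT.
by rewrite iN mem_natE; case/orP: fi => [->|/andP[_ ->]]; rewrite ?orbT.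
Qed.

Let num (r : rel nat) (K : {set 'I_n}) := count (fun t => avo r t && (peaks hs t == K)) L.

Lemma sum_num r (c : pred {set 'I_n}) :
  \sum_(K | c K) num r K = count (fun t => avo r t && c (peaks hs t)) L.
Proof.
rewrite /num; under eq_bigr do rewrite -sum1_count.
rewrite -sum1_count (exchange_big_dep (fun t => avo r t && c (peaks hs t))) /=;
  last first.
  by move=> K t cK /andP[-> /eqP ->].
apply: eq_bigr => t /andP[at_ ct]; rewrite (big_pred1 (peaks hs t)) // => K /=.
by rewrite at_ eq_sym; case: eqP => [->|]; rewrite ?ct ?andbF.
Qed.

(** The counts of block fillings without interior peaks agree by [count_blocks], and they
determine the distribution of the peak sets. *)
Lemma count_peaks_eq K : num ltn K = num gtn K.
Proof.
suff : (Posz (num ltn K) - Posz (num gtn K) = 0)%R by move/eqP;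
  rewrite subr_eq0 => /eqP [].
have num0 r K' : ~~ peak_like K' -> num r K' = 0.
  move=> nok; apply/eqP; rewrite /num -leqn0 leqNgt -has_count; apply/negP.
  by move/hasP => [t _ /andP[_ /eqP e]]; rewrite -e peaks_peak_like in nok.
move: K; apply: (@sparse_determined n (fun K =>
  Posz (num ltn K) - Posz (num gtn K))%R peak_like).
- by move=> M /andP[].
- move=> M K /subsetP MK /andP[/sparseP sK /forall_inP lK]; apply/andP; split.
    by apply/sparseP => i j /MK iK /MK jK; exact: sK.
  by apply/forall_inP => i /MK; exact: lK.
- by move=> M nok; rewrite !num0 // subrr.
- move=> K plK; rewrite sumrB.
  have e r : (\sum_(M : {set 'I_n} | [disjoint M & patch K]) Posz (num r M))%R =
     Posz (count (fun t => avo r t && [disjoint peaks hs t & patch K]) L).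
    by rewrite -(sum_num r (fun M => [disjoint M & patch K])) -natz natr_sum;
      apply: eq_bigr => M _; rewrite natz.
  rewrite !e; apply/eqP; rewrite subr_eq0; apply/eqP; congr Posz.
  have e' r : count (fun t => avo r t && [disjoint peaks hs t & patch K]) L =
      count (fun t => [&& fills hs t,
        ~~ has_chain r k hs t & all (no_peak ltn) (segs (glue K) t)]) L.
    apply: eq_count => t /=; rewrite /avo -andbA.
    case: (boolP (fills hs t)) => //= /and3P[/eqP st _ _].
    by rewrite disjoint_patch.
  by rewrite !e'; apply: count_blocks => //; exact: glue_level.
Qed.
End Core.

Definition avoids (r : rel nat) (k : nat) (hs t : seq nat) : bool :=
  fills hs t && ~~ has_chain r k hs t.

(** The number of fillings with given rows and given peak set is the same for r1 and r2, so the
words of one kind may be matched with those of the other by their positions in two lists. *)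
Definition transfer (r1 r2 : rel nat) (k : nat) (hs t : seq nat) : seq nat :=
  let L := permutations (sort leq t) in
  let P r t' := avoids r k hs t' && (peaks hs t' == peaks hs t) in
  nth [::] (filter (P r2) L) (index t (filter (P r1) L)).

Definition monotone_rel (r : rel nat) := r = ltn \/ r = gtn.

Section Transfer.
Variables (r1 r2 : rel nat) (k : nat) (hs : seq nat).
Hypothesis hs_sorted : sorted geq hs.
Hypothesis k_gt0 : 0 < k.
Hypothesis (r1_mono : monotone_rel r1) (r2_mono : monotone_rel r2).

Let P r t t' := avoids r k hs t' && (peaks hs t' == peaks hs t).

Lemma transfer_index t : avoids r1 k hs t ->
  t \in filter (P r1 t) (permutations (sort leq t)) /\
  index t (filter (P r1 t) (permutations (sort leq t))) <
  size (filter (P r2 t) (permutations (sort leq t))).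
Proof.
move=> at_; have tL : t \in filter (P r1 t) (permutations (sort leq t)).
  by rewrite mem_filter /P at_ eqxx mem_permutations perm_sym perm_sort perm_refl.
split=> //; suff -> : size (filter (P r2 t) (permutations (sort leq t))) =
  size (filter (P r1 t) (permutations (sort leq t))) by rewrite index_mem.
have e := count_peaks_eq (sort leq t) hs_sorted k_gt0 (peaks hs t).
rewrite !size_filter /P /avoids.
by case: r1_mono => ->; case: r2_mono => ->; rewrite ?e.
Qed.

Lemma transferP t : avoids r1 k hs t ->
  [/\ avoids r2 k hs (transfer r1 r2 k hs t), perm_eq (transfer r1 r2 k hs t) t &
      peaks hs (transfer r1 r2 k hs t) = peaks hs t].
Proof.
move=> /transfer_index [_ it]; have := mem_nth [::] it.
rewrite -/(transfer r1 r2 k hs t) mem_filter => /andP[/andP[-> /eqP ->]].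
by rewrite mem_permutations => /perm_trans -> //; rewrite perm_sort.
Qed.

Lemma transfer_inj : {in avoids r1 k hs &, injective (transfer r1 r2 k hs)}.
Proof.
move=> t1 t2 a1 a2 e; have [_ p1 k1] := transferP a1; have [_ p2 k2] := transferP a2.
have es : sort leq t1 = sort leq t2.
  apply/perm_sortP; [exact: leq_total | exact: leq_trans | exact: anti_leq|].
  by rewrite -(permPl p1) e.
have ek : peaks hs t1 = peaks hs t2 by rewrite -k1 -k2 e.
have [m1 i1] := transfer_index a1; have [m2 i2] := transfer_index a2.
move: e; rewrite /transfer -/(P r1 t1) -/(P r2 t1) -/(P r1 t2) -/(P r2 t2).
have eP r : P r t1 = P r t2 by rewrite /P ek.
rewrite !eP es in m1 i1 *; move=> /eqP;
  rewrite nth_uniq ?filter_uniq ?permutations_uniq //.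
by move=> /eqP ei; rewrite -(nth_index [::] m1) ei nth_index.
Qed.

End Transfer.

(** * White squares *)

Definition copy (m : nat) (s : 'S_m) (hs t : seq nat) (d : {ffun 'I_m ->
  'I_(size hs)}) : bool :=
  [forall i : 'I_m, forall j : 'I_m,
    [&& (i < j) ==> (d i < d j), nth 0 t (d i) < nth 0 hs (d j) &
        (s i < s j) ==> (nth 0 t (d i) < nth 0 t (d j))]].

Lemma copyP m (s : 'S_m) hs t (d : {ffun 'I_m -> 'I_(size hs)}) : reflect
  [/\ forall i j : 'I_m, i < j -> d i < d j, forall i j, nth 0 t (d i) < nth 0 hs (d j) &
      forall i j, s i < s j -> nth 0 t (d i) < nth 0 t (d j)]
  (@copy m s hs t d).
Proof.
apply: (iffP forallP) => [h|[h1 h2 h3] i].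
  by split=> i j; have /forallP/(_ j)/and3P[/implyP a b /implyP c] := h i.
by apply/forallP => j; apply/and3P; split; [apply/implyP;
  exact: h1 | exact: h2 | apply/implyP; exact: h3].
Qed.

Definition occurs (m : nat) (s : 'S_m) (hs t : seq nat) : bool :=
  [exists d, @copy m s hs t d].

Section Lift.
Variables (b : nat) (tau : 'S_b) (hs : seq nat).
Hypothesis hs_sorted : sorted geq hs.
Let n := size hs.

Lemma hs_anti i j : i <= j -> nth 0 hs j <= nth 0 hs i.
Proof.
move=> ij; case: (ltnP j n) => jn; last by rewrite nth_default.
move: hs_sorted => /(sorted_leq_nth (fun a b c (h1 : geq b a) (h2 : geq a c) =>
  leq_trans h2 h1) leqnn 0).
by apply=> //; rewrite inE // (leq_ltn_trans ij).
Qed.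

Section White.
Variable t : seq nat.

Definition white (c r : nat) : bool := (r < nth 0 hs c) &&
  [exists d, @copy b tau hs t d && [forall i, (c < d i) && (r < nth 0 t (d i))]].

Lemma whiteP c r : reflect (r < nth 0 hs c /\
  exists2 d, @copy b tau hs t d & forall i, c < d i /\ r < nth 0 t (d i)) (white c r).
Proof.
apply: (iffP andP) => [[rc /existsP[d /andP[cd /forallP h]]]|[rc [d cd h]]].
  by split=> //; exists d => // i; apply/andP.
by split=> //; apply/existsP; exists d; rewrite cd; apply/forallP => i; apply/andP.
Qed.

Lemma white_mono c r c' r' : c <= c' -> r <= r' -> white c' r' -> white c r.
Proof.
move=> cc rr /whiteP[rc [d cd h]]; apply/whiteP; split.
  by have := hs_anti cc; lia.
by exists d => // i; have := h i; lia.
Qed.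

(** White squares are closed under moving up or left, so each column is white down to a certain
height, and these heights do not increase. *)
Definition white_height (c : nat) : nat :=
  find (fun r => ~~ white c r) (iota 0 (nth 0 hs c)).

Lemma ltn_white_height c r : (r < white_height c) = white c r.
Proof.
apply/idP/idP => [rw|wr].
  have rh : r < nth 0 hs c.
    by apply: leq_trans rw _; rewrite -[X in _ <= X](size_iota 0) find_size.
  by have := before_find 0 rw; rewrite nth_iota // add0n => /negbFE.
have /whiteP[rh _] := wr.
rewrite ltnNge; apply/negP => wr'.
have ha : has (fun r => ~~ white c r) (iota 0 (nth 0 hs c)).
  by rewrite has_find size_iota (leq_ltn_trans wr' rh).
have := nth_find 0 ha; rewrite -/(white_height c) nth_iota ?add0n;
  last exact: leq_ltn_trans wr' rh.
by rewrite (white_mono (leqnn c) wr' wr).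
Qed.

Lemma white_height_anti c c' : c <= c' -> white_height c' <= white_height c.
Proof.
move=> cc; rewrite leqNgt; apply/negP; rewrite ltn_white_height => w.
have := white_mono cc (leqnn _) w; by rewrite -ltn_white_height ltnn.
Qed.

Definition white_col (c : nat) : bool := nth 0 t c < white_height c.
Definition white_cols : seq nat := [seq c <- iota 0 n | white_col c].
Definition white_heights : seq nat := [seq white_height c | c <- white_cols].
Definition white_word : seq nat := [seq nth 0 t c | c <- white_cols].

Lemma white_cols_sorted : sorted ltn white_cols.
Proof. by apply: sorted_filter; [exact: ltn_trans | exact: iota_ltn_sorted]. Qed.

Lemma white_cols_uniq : uniq white_cols.
Proof. exact: filter_uniq (iota_uniq _ _). Qed.

Lemma mem_white_cols c : (c \in white_cols) = white_col c && (c < n).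
Proof. by rewrite mem_filter mem_iota. Qed.

Lemma white_heights_sorted : sorted geq white_heights.
Proof.
rewrite /white_heights; have := white_cols_sorted;
  apply: (homo_sorted (e := ltn)) => x y xy.
exact: white_height_anti (ltnW xy).
Qed.

Lemma fills_white : fills hs t -> fills white_heights white_word.
Proof.
move=> /and3P[/eqP st ut _]; apply/and3P; split; first by rewrite !size_map.
  rewrite map_inj_in_uniq ?white_cols_uniq // => x y.
  rewrite !mem_white_cols => /andP[_ xn] /andP[_ yn] /eqP.
  by rewrite nth_uniq ?st // => /eqP.
have : all white_col white_cols by exact: filter_all.
by rewrite /white_heights /white_word; elim: white_cols => //= c cs IH /andP[h /IH ->];
  rewrite andbT.
Qed.

(** An occurrence of the direct sum is an occurrence of s all of whose squares are white.  For
the converse it suffices to take a copy of [tau] for the corner of the occurrence, the square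
in its last column and its lowest row. *)
Lemma occurs_dsum a (s : 'S_a) : 0 < a ->
  occurs (dsum s tau) hs t <->
  exists e : 'I_a -> 'I_n, [/\ forall i j : 'I_a, i < j -> e i < e j,
    forall i j, s i < s j -> nth 0 t (e i) < nth 0 t (e j) &
    forall i j, white (e j) (nth 0 t (e i))].
Proof.
move=> a0; split.
  move=> /existsP[d /copyP[h1 h2 h3]].
  exists (fun i => d (lshift b i)); split=> [i j ij|i j ij|i j]; first exact: h1.
    by apply: h3; rewrite !permE /dsum_fun !(unsplitK (inl _)).
  apply/whiteP; split; first exact: h2.
  exists [ffun j => d (rshift a j)].
    apply/copyP; split=> x y; rewrite !ffunE => *; [apply: h1 | exact: h2 | apply: h3].
      by rewrite /= ltn_add2l.
    by rewrite !permE /dsum_fun !(unsplitK (inr _)) /= ltn_add2l.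
  move=> x; rewrite ffunE; split.
    by apply: h1 => /=; rewrite ltn_addr.
  apply: h3; rewrite !permE /dsum_fun (unsplitK (inl _)) (unsplitK (inr _)) /=.
  by rewrite ltn_addr.
move=> [e [h1 h2 h3]].
have lta : a.-1 < a by rewrite ltn_predL.
pose last_ : 'I_a := Ordinal lta.
have [imax _ hmax] := @arg_maxnP 'I_a last_ xpredT (fun i => nth 0 t (e i)) isT.
(* The corner of the occurrence: last column and lowest row. *)
have /whiteP[_ [d /copyP[d1 d2 d3] hd]] := h3 imax last_.
have e_last i : e i <= e last_.
  case: (ltngtP i last_) => il; first exact: ltnW (h1 _ _ il).
    by move: (ltn_ord i) il => /=; lia.
  by rewrite (val_inj il).
have ed i j : e i < d j by have := e_last i; have [] := hd j; lia.
have td i j : nth 0 t (e i) < nth 0 t (d j).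
  by have := hmax i isT; have [] := hd j; rewrite /=; lia.
apply/existsP; exists [ffun x => match split x with inl i => e i | inr j => d j end].
apply/copyP; split=> x y; rewrite !ffunE.
- move=> xy; have : unsplit (split x) < unsplit (split y) by rewrite !splitK.
  case: (split x) => i; case: (split y) => j /=; first exact: h1.
  + by rewrite ed.
  + by move: (ltn_ord j); lia.
  + by rewrite ltn_add2l; exact: d1.
- case: (split x) => i; case: (split y) => j.
  + by have /whiteP[] := h3 i j.
  + exact: ltn_trans (td i j) (d2 j j).
  + by apply: leq_trans (d2 i i) _; apply: hs_anti; apply: ltnW.
  + exact: d2.
- rewrite !permE /dsum_fun; case: (split x) => i; case: (split y) => j /=.
  + exact: h2.
  + by rewrite td.
  + by move: (ltn_ord (s j)); lia.
  + by rewrite ltn_add2l; exact: d3.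
Qed.


Lemma ordinals_sorted k : sorted (fun i j : 'I_k => i < j) (enum 'I_k).
Proof.
by have := iota_ltn_sorted 0 k; rewrite -val_enum_ord sorted_map.
Qed.

Lemma white_cols_take x c : x \in white_cols -> c < size white_cols ->
  (x \in take c.+1 white_cols) = (x <= nth 0 white_cols c).
Proof.
move=> xw cw; rewrite in_take_leq // ltnS.
have ex : x = nth 0 white_cols (index x white_cols) by rewrite nth_index.
case: (leqP (index x white_cols) c) => ic; symmetry.
  by rewrite ex; apply: (sorted_leq_nth leq_trans leqnn 0 (sub_sorted ltnW
    white_cols_sorted)); rewrite ?inE ?index_mem.
apply/negbTE; rewrite -ltnNge ex.
by apply: (sorted_ltn_nth ltn_trans 0 white_cols_sorted); rewrite ?inE ?index_mem.
Qed.

(** The white part of a filling, as a filling of the diagram of white heights. *)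
Lemma white_chain k (r : rel nat) : 0 < k -> transitive r ->
  (exists e : 'I_k -> 'I_n, [/\ forall i j : 'I_k, i < j -> e i < e j,
    forall i j : 'I_k, i < j -> r (nth 0 t (e i)) (nth 0 t (e j)) &
    forall i j, white (e j) (nth 0 t (e i))]) <->
  has_chain r k white_heights white_word.
Proof.
move=> k0 rt; split=> [[e [h1 h2 h3]]|].
  have ew i : val (e i) \in white_cols by rewrite mem_white_cols ltn_ord andbT
    /white_col ltn_white_height h3.
  have ltk : k.-1 < k by rewrite ltn_predL.
  pose il : 'I_k := Ordinal ltk.
  have e_last i : e i <= e il.
    case: (ltngtP i il) => il'; first exact: ltnW (h1 _ _ il').
      by move: (ltn_ord i) il' => /=; lia.
    by rewrite (val_inj il').
  have cw : index (val (e il)) white_cols < size white_cols by rewrite index_mem.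
  apply/hasP; exists (index (val (e il)) white_cols);
    first by rewrite mem_iota /= size_map.
  apply/chainP; exists [seq nth 0 t (e i) | i <- enum 'I_k]; split.
  - rewrite (map_comp (nth 0 t) (fun i => val (e i))) /white_word -map_take.
    apply: map_subseq; apply: (sorted_sub_subseq ltn_trans ltnn).
    + rewrite sorted_map; apply: sub_sorted (ordinals_sorted k) => i j; exact: h1.
    + apply: subseq_sorted ltn_trans _ _ (take_subseq _ _) white_cols_sorted.
    + by move=> _ /mapP[i _ ->]; rewrite white_cols_take // nth_index // e_last.
  - rewrite sorted_map; apply: sub_sorted (ordinals_sorted k) => i j; exact: h2.
  - by rewrite size_map size_enum_ord.
  - apply/allP => _ /mapP[i _ ->].
    by rewrite (nth_map 0) // nth_index // ltn_white_height h3.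
move/hasP => [c]; rewrite mem_iota add0n /= size_map => cw /chainP[u [su so sz al]].
move: su; rewrite /white_word -map_take => /subseqP[m _]; rewrite -map_mask.
set cs := mask m _ => eu.
have szc : size cs = k by rewrite -sz eu size_map.
have csub x : x \in cs -> x \in take c.+1 white_cols by exact: mem_mask.
have csn x : x \in cs -> x < n.
  by move/csub/mem_take; rewrite mem_white_cols => /andP[].
have socs : sorted ltn cs.
  apply: (sorted_mask ltn_trans).
  by apply: subseq_sorted ltn_trans _ _ (take_subseq _ _) white_cols_sorted.
have nc (i : 'I_k) : nth 0 cs i \in cs by rewrite mem_nth // szc.
exists (fun i => Ordinal (csn _ (nc i))); split=> [i j ij|i j ij|i j] /=.
- by apply: (sorted_ltn_nth ltn_trans 0 socs); rewrite ?inE ?szc.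
- have := sorted_ltn_nth rt 0 so; rewrite eu => /(_ i j).
  by rewrite !inE size_map szc !(nth_map 0) ?szc //; apply.
- have ti : nth 0 t (nth 0 cs i) < nth 0 white_heights c.
    by apply: (allP al); rewrite eu; exact: map_f.
  rewrite (nth_map 0) // ltn_white_height in ti; apply: white_mono ti => //.
  by have cj := csub _ (nc j); rewrite -white_cols_take // (mem_take cj).
Qed.

End White.

Section Neighbours.
Variables (t : seq nat) (c : nat).
Hypothesis c_level : nth 0 hs c = nth 0 hs c.+1.

(** If the square to the right is not white, then each copy of [tau] starts in that very column. *)
Lemma white_next r : white t c r -> ~~ white t c.+1 r -> r < nth 0 t c.+1.
Proof.
move=> /whiteP[rc [d cd h]] /whiteP nw.
case: (boolP [exists i, val (d i) == c.+1]) => [/existsP[i /eqP e]|].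
  by rewrite -e; have [] := h i.
rewrite negb_exists => /forallP ne; case: nw; rewrite -c_level; split=> //.
exists d => // i; have [h1 h2] := h i; split=> //.
by rewrite ltn_neqAle h1 eq_sym ne.
Qed.

(** Otherwise [white_next] puts the 1 of the next column below all the white squares. *)
Lemma height_next_white : white_col t c.+1 -> white_height t c.+1 = white_height t c.
Proof.
move=> w; apply/eqP; rewrite eqn_leq white_height_anti ?leqnSn //= leqNgt;
  apply/negP => lt.
have := @white_next (white_height t c.+1);
  rewrite -ltn_white_height lt -ltn_white_height ltnn => /(_ isT isT).
by move: w; rewrite /white_col; lia.
Qed.

Lemma height_next_gray : ~~ white_col t c.+1 -> white_height t c <= nth 0 t c.+1.
Proof.
rewrite /white_col -leqNgt => g;
  case: (leqP (white_height t c) (white_height t c.+1)) => [le|lt].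
  exact: leq_trans le g.
have := @white_next (white_height t c).-1; rewrite -ltn_white_height -ltn_white_height;
  lia.
Qed.

Lemma asc_white_gray : white_col t c -> ~~ white_col t c.+1 -> nth 0 t c < nth 0 t c.+1.
Proof. by move=> w /height_next_gray; move: w; rewrite /white_col; lia. Qed.

Lemma desc_gray_white : ~~ white_col t c -> white_col t c.+1 -> nth 0 t c.+1 < nth 0 t c.
Proof. by move=> g w; have := height_next_white w; move: g w; rewrite /white_col;
  lia. Qed.

End Neighbours.


(** The word t with its white letters replaced, in order, by u. *)
Definition replace_white (t u : seq nat) : seq nat :=
  [seq if white_col t c then nth 0 u (index c (white_cols t)) else nth 0 t c | c <-
    iota 0 n].

Lemma nth_all2_ltn (v h : seq nat) : size v = size h ->
  all2 ltn v h <-> forall i, i < size v -> nth 0 v i < nth 0 h i.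
Proof.
elim: v h => [|x v IH] [|y h] //= [sv]; split=> [/andP[xy a] [|i] //= iv|a].
  by move/(IH _ sv): a; apply.
by rewrite (a 0) //=; apply/(IH _ sv) => i iv; apply: (a i.+1).
Qed.

Section ReplaceWhite.
Variables t u : seq nat.
Hypothesis wt : fills hs t.
Hypothesis wu : fills (white_heights t) u.
Hypothesis pu : perm_eq u (white_word t).

Let w := replace_white t u.

Lemma nth_replace_white c : c < n ->
  nth 0 w c = if white_col t c then nth 0 u (index c (white_cols t)) else nth 0 t c.
Proof. by move=> cn; rewrite (nth_map 0) ?size_iota // nth_iota. Qed.

Lemma size_u : size u = size (white_cols t).
Proof. by rewrite (perm_size pu) size_map. Qed.

Lemma replace_white_lt c : c < n -> white_col t c -> nth 0 w c < white_height t c.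
Proof.
move=> cn cw; rewrite nth_replace_white // cw.
have ci : c \in white_cols t by rewrite mem_white_cols cw.
have ci' : index c (white_cols t) < size (white_cols t) by rewrite index_mem.
have /and3P[/eqP su _ au] := wu.
have := (nth_all2_ltn su).1 au (index c (white_cols t)).
by rewrite size_u (nth_map 0) // nth_index //; apply.
Qed.

(** A copy of [tau] with no white letter is the same in both words.  If a copy for the square
(c, r) has a white letter, the square of that letter is white, lies further to the right and
below, and decides for (c, r); hence the induction on the distance to the last column. *)
Lemma white_replace_white c r : white w c r = white t c r.
Proof.
have copy_eq (d : {ffun 'I_b ->
  'I_(size hs)}) : (forall i, ~~ white_col t (val (d i))) ->
    @copy b tau hs w d = @copy b tau hs t d.
  move=> g; have e i : nth 0 w (d i) =
    nth 0 t (d i) by rewrite nth_replace_white // (negPf (g i)).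
  by apply: eq_forallb => i; apply: eq_forallb => j; rewrite !e.
apply/idP/idP.
  move=> /whiteP[rc [d cd h]].
  case: (boolP [exists i, white_col t (val (d i))]) => [/existsP[i iw]|].
    have := replace_white_lt (ltn_ord (d i)) iw; rewrite ltn_white_height.
    by apply: white_mono; have [] := h i; lia.
  rewrite negb_exists => /forallP g; apply/whiteP; split=> //; exists d;
    first by rewrite -copy_eq.
  by move=> i; have := h i; rewrite nth_replace_white // (negPf (g i)).
have [m] := ubnP (n - c); elim: m c r => // m IH c r; rewrite ltnS => cm.
move=> /whiteP[rc [d cd h]].
case: (boolP [exists i, white_col t (val (d i))]) => [/existsP[i iw]|].
  have [ci ri] := h i.
  apply: (white_mono (ltnW ci) (ltnW ri)); apply: IH; last by rewrite -ltn_white_height.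
  by have := ltn_ord (d i); move: cm; rewrite /n; lia.
rewrite negb_exists => /forallP g; apply/whiteP; split=> //; exists d;
  first by rewrite copy_eq.
by move=> i; have := h i; rewrite nth_replace_white // (negPf (g i)).
Qed.

Lemma white_height_replace c : white_height w c = white_height t c.
Proof. by apply: eq_find => r; rewrite white_replace_white. Qed.

Lemma white_col_replace c : c < n -> white_col w c = white_col t c.
Proof.
move=> cn; rewrite {1}/white_col white_height_replace;
  case: (boolP (white_col t c)) => cw.
  by rewrite replace_white_lt.
by rewrite nth_replace_white // (negPf cw); exact: negbTE.
Qed.

Lemma white_cols_replace : white_cols w = white_cols t.
Proof. by apply: eq_in_filter => c; rewrite mem_iota => /white_col_replace. Qed.

Lemma white_heights_replace : white_heights w = white_heights t.
Proof. by rewrite /white_heights white_cols_replace; apply: eq_map => c;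
  rewrite white_height_replace. Qed.

Lemma map_index (s v : seq nat) : uniq s -> size v = size s ->
  [seq nth 0 v (index c s) | c <- s] = v.
Proof.
move=> us sv; apply: (@eq_from_nth _ 0); rewrite size_map // => i is_.
by rewrite (nth_map 0) // index_uniq.
Qed.

Lemma white_word_replace : white_word w = u.
Proof.
rewrite /white_word white_cols_replace -[RHS](map_index (white_cols_uniq t) size_u).
by apply/eq_in_map => c; rewrite mem_white_cols => /andP[cw cn];
  rewrite nth_replace_white // cw.
Qed.

Lemma perm_replace_white : perm_eq w t.
Proof.
have /and3P[/eqP st _ _] := wt.
rewrite -[X in perm_eq _ X](mkseq_nth 0) st /w /replace_white.
rewrite perm_sym /mkseq -/n;
  have p := introT permPl (perm_filterC (white_col t) (iota 0 n)).
apply: (@perm_trans _ (map (nth 0 t) (white_cols t ++ filter (predC (white_col t))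
  (iota 0 n)))).
  by apply: perm_map; rewrite perm_sym; exact: p.
rewrite perm_sym; apply: (@perm_trans _ (map (fun c =>
  if white_col t c then nth 0 u (index c (white_cols t)) else nth 0 t c)
    (white_cols t ++ filter (predC (white_col t)) (iota 0 n)))).
  by apply: perm_map; rewrite perm_sym; exact: p.
rewrite !map_cat; apply: perm_cat.
  rewrite (_ : map _ _ = u); first exact: pu.
  rewrite -[RHS](map_index (white_cols_uniq t) size_u).
  by apply/eq_in_map => c; rewrite mem_white_cols => /andP[->].
rewrite (_ : map _ _ = map (nth 0 t) (filter (predC (white_col t)) (iota 0 n))) //.
by apply/eq_in_map => c; rewrite mem_filter /= => /andP[/negPf ->].
Qed.

Lemma fills_replace_white : fills hs w.
Proof.
have /and3P[/eqP st ut at_] := wt.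
have sw : size w = size hs by rewrite (perm_size perm_replace_white).
apply/and3P; split; first by rewrite sw.
  by rewrite (perm_uniq perm_replace_white).
apply/(nth_all2_ltn sw) => c; rewrite sw => cn.
case: (boolP (white_col t c)) => cw; last first.
  rewrite nth_replace_white // (negPf cw).
  by move/(nth_all2_ltn st): at_; apply; rewrite st.
by have := replace_white_lt cn cw; rewrite ltn_white_height => /whiteP[].
Qed.

End ReplaceWhite.

(** Between neighbouring columns of the same length, a white 1 is always in a smaller row than a
gray one.  So
at a white position there is a peak only if both neighbours are white, and then it is one of
the white part; at a gray position only the gray neighbours matter. *)
Lemma peak_level t i : fills hs t -> level hs i ->
  (nth 0 t i.-1 < nth 0 t i) && (nth 0 t i.+1 < nth 0 t i) =
  if white_col t i then
    [&& white_col t i.-1,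
      white_col t i.+1 & mem_nat (peaks (white_heights t) (white_word t)) (index i
        (white_cols t))]
  else (white_col t i.-1 || (nth 0 t i.-1 < nth 0 t i)) &&
       (white_col t i.+1 || (nth 0 t i.+1 < nth 0 t i)).
Proof.
move=> wt /and4P[i0 it /eqP l1 /eqP l2].
have l1' : nth 0 hs i.-1 = nth 0 hs i.-1.+1 by rewrite prednK.
case: (boolP (white_col t i)) => wi; last first.
  congr (_ && _).
    case: (boolP (white_col t i.-1)) => //= wj.
    by have := asc_white_gray l1' wj; rewrite prednK // => /(_ wi) ->.
  case: (boolP (white_col t i.+1)) => //= wj.
  by rewrite (desc_gray_white l2 wi wj).
case: (boolP (white_col t i.-1)) => w1 /=; last first.
  have := desc_gray_white l1' w1; rewrite prednK // => /(_ wi); lia.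
case: (boolP (white_col t i.+1)) => w2 /=; last first.
  by have := asc_white_gray l2 wi w2; lia.
have := @height_next_white t _ l1'; rewrite prednK // => /(_ wi) e1.
have e2 := height_next_white l2 w2.
have in0 : i < n by exact: ltnW.
have split_iota : white_cols t = [seq c <- iota 0 i.-1 | white_col t c] ++ [:: i.-1; i;
  i.+1] ++
    [seq c <- iota i.+2 (n - i.+2) | white_col t c].
  rewrite /white_cols -/n; have -> : n = i.-1 + (3 + (n - i.+2)) by lia.
  rewrite iotaD filter_cat add0n iotaD filter_cat; congr (_ ++ _).
  have e3 : i.-1 + 3 = i.+2 by lia.
  rewrite e3 (_ : i.-1 + (3 + (n - i.+2)) - i.+2 = n - i.+2); last by lia.
  by congr (_ ++ _); rewrite /= prednK // w1 wi w2.
set pre := filter _ (iota 0 i.-1) in split_iota.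
have ix : index i (white_cols t) = (size pre).+1.
  rewrite split_iota index_cat ifN; last by rewrite mem_filter mem_iota; lia.
  by rewrite /= eqxx ifN ?addn1 // ; lia.
have nths j (f : nat -> nat) : j < 3 ->
  nth 0 (map f (white_cols t)) (size pre + j) = f (i.-1 + j).
  move=> j3; rewrite split_iota map_cat nth_cat size_map ltnNge leq_addr /= addKn.
  by case: j j3 => [|[|[|]]] //= _; congr f; lia.
have sz : (size pre).+2 < size (white_cols t) by rewrite split_iota size_cat /=; lia.
rewrite ix; symmetry; apply/mem_natP/idP => [[j]|pk].
  rewrite inE => /and3P[_ p1 p2] ej; move: p1 p2; rewrite -ej /= /white_word.
  have := nths 0 (nth 0 t) isT; have := nths 1 (nth 0 t) isT;
    have := nths 2 (nth 0 t) isT.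
  rewrite !addn0 addn1 addn2 => -> -> ->.
  have -> : i.-1 + 1 = i by lia.
  have -> : i.-1 + 2 = i.+1 by lia.
  by move=> -> ->.
have jn : (size pre).+1 < size (white_heights t) by rewrite size_map; exact: ltnW.
exists (Ordinal jn) => //; rewrite inE /level /= size_map sz /white_heights /white_word.
have := nths 0 (nth 0 t) isT; have := nths 1 (nth 0 t) isT; have := nths 2 (nth 0 t) isT.
have := nths 0 (white_height t) isT; have := nths 1 (white_height t) isT;
  have := nths 2 (white_height t) isT.
rewrite !addn0 addn1 addn2 => -> -> -> -> -> ->.
have -> : i.-1 + 1 = i by lia.
have -> : i.-1 + 2 = i.+1 by lia.
by rewrite -e1 e2 !eqxx /=.
Qed.

Lemma peaks_replace_white t u : fills hs t -> fills (white_heights t) u ->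
  perm_eq u (white_word t) ->
  peaks (white_heights t) u = peaks (white_heights t) (white_word t) ->
    peaks hs (replace_white t u) = peaks hs t.
Proof.
move=> wt wu pu pk; apply/setP => i; rewrite !inE.
case: (boolP (level hs i)) => //= li.
have ww := fills_replace_white wt wu pu; have /and4P[i0 it _ _] := li.
rewrite !peak_level // white_heights_replace // white_word_replace // pk
  white_cols_replace // !white_col_replace //; try exact: leq_ltn_trans (leq_pred _) _.
case: ifP => // wi.
have e c : c < n -> white_col t c || (nth 0 (replace_white t u) c < nth 0
  (replace_white t u) i) =
    white_col t c || (nth 0 t c < nth 0 t i).
  move=> cn; case: (boolP (white_col t c)) => //= wc.
  by rewrite !nth_replace_white // (negPf wc) wi.
by rewrite !e // (leq_ltn_trans (leq_pred _)).
Qed.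

End Lift.

(** * Transversals as words *)

Section Dsum.
Variables (k b : nat) (tau : 'S_b) (hs t : seq nat).
Hypothesis hs_sorted : sorted geq hs.
Hypothesis k_gt0 : 0 < k.

Lemma occurs_I : occurs (dsum (perm_I k) tau) hs t =
  has_chain ltn k (white_heights tau hs t) (white_word tau hs t).
Proof.
apply/idP/idP => [/(occurs_dsum tau hs_sorted t _ k_gt0) | /(white_chain tau hs_sorted
  t k_gt0 ltn_trans)] [e [h1 h2 h3]].
  apply/(white_chain tau hs_sorted t k_gt0 ltn_trans); exists e; split=> // i j ij.
  by apply: h2; rewrite !perm1.
apply/(occurs_dsum tau hs_sorted t _ k_gt0); exists e; split=> // i j.
by rewrite !perm1; exact: h2.
Qed.

Lemma occurs_J : occurs (dsum (perm_J k) tau) hs t =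
  has_chain gtn k (white_heights tau hs t) (white_word tau hs t).
Proof.
apply/idP/idP => [/(occurs_dsum tau hs_sorted t _ k_gt0) | /(white_chain tau hs_sorted
  t k_gt0 gtn_trans)] [e [h1 h2 h3]].
  apply/(white_chain tau hs_sorted t k_gt0 gtn_trans); exists e; split=> // i j ij.
  by apply: h2; rewrite !permE /=; move: (ltn_ord i) (ltn_ord j) ij; lia.
apply/(occurs_dsum tau hs_sorted t _ k_gt0); exists e; split=> // i j.
by rewrite !permE /= => ij; apply: h2; move: (ltn_ord i) (ltn_ord j) ij; lia.
Qed.

End Dsum.

Section Diagram.
Variable lam : seq nat.
Hypothesis lam_part : is_partition lam.

Let n := ncols lam.
Definition heights : seq nat := [seq col_len lam i | i <- iota 0 n].

Lemma size_heights : size heights = n.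
Proof. by rewrite size_map size_iota. Qed.

Lemma nth_heights c : c < n -> nth 0 heights c = col_len lam c.
Proof. by move=> cn; rewrite (nth_map 0) ?size_iota // nth_iota. Qed.

(** Both sides say that the square in column c and row r belongs to the diagram. *)
Lemma col_lenE c r : (c < nth 0 lam r) = (r < col_len lam c).
Proof.
move: lam_part => /andP[so _]; rewrite /col_len.
elim: (lam) so r => [|p l IH] so r /=; first by rewrite nth_nil.
have sol : sorted geq l by case: (l) so => //= ? ? /andP[].
case: (ltnP c p) => cp.
  by case: r => [|r] /=; rewrite ?cp // IH.
have allp : all (geq p) l.
  by move: so; rewrite /= path_sortedE => [/andP[]//|x y z]; rewrite /geq /=; lia.
have -> : count (fun p0 => c < p0) l = 0.
  apply/eqP; rewrite -leqn0 leqNgt -has_count; apply/hasPn => x /(allP allp).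
  by rewrite /geq /=; lia.
case: r => [|r] /=; first by rewrite ltnNge cp.
apply/negbTE; rewrite -leqNgt; case: (ltnP r (size l)) => rl; last by rewrite nth_default.
by have := allP allp _ (mem_nth 0 rl); rewrite /geq /=; lia.
Qed.

Lemma heights_sorted : sorted geq heights.
Proof.
rewrite sorted_map; apply: sub_sorted (iota_ltn_sorted 0 n) => i j ij.
by rewrite /= /geq /=; apply: sub_count => p; exact: ltn_trans.
Qed.

Lemma mem_diagram (x : square lam) : (x \in diagram lam) = (x.2 < nth 0 heights x.1).
Proof. by rewrite inE col_lenE nth_heights. Qed.

Definition word (T : {set square lam}) : seq nat := [seq row_of T i | i <- iota 0 n].
Definition of_word (w : seq nat) : {set square lam} :=
  [set x : square lam | nth 0 w x.1 == x.2].

Lemma size_word T : size (word T) = size heights.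
Proof. by rewrite !size_map. Qed.

Lemma nth_word T c : c < n -> nth 0 (word T) c = row_of T c.
Proof. by move=> cn; rewrite (nth_map 0) ?size_iota // nth_iota. Qed.

Section Transversal.
Variable T : {set square lam}.
Hypothesis trT : T \in transversals lam.

Lemma row_ofP (x : square lam) : (x \in T) = (row_of T x.1 == x.2).
Proof.
move: trT; rewrite inE => /and3P[_ /forallP /(_ x.1) /cards1P[y ey] _].
have cy z : (z \in T) && (z.1 == x.1) = (z == y).
  by have := in_set1 z y; rewrite -ey inE.
rewrite /row_of; case: pickP => [z /andP[zT zx]|/(_ y)].
  have zy : z = y by apply/eqP; rewrite -cy zT.
  apply/idP/eqP => [xT|e].
    by congr (nat_of_ord _.2); apply/eqP; rewrite zy eq_sym -cy xT eqxx.
  suff -> : x = z by [].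
  by apply/eqP; rewrite -pair_eqE /pair_eq -!val_eqE /= eq_sym zx e /=.
by have := cy y; rewrite eqxx => yy nT; have := etrans (esym nT) yy.
Qed.

Lemma of_wordK : of_word (word T) = T.
Proof. by apply/setP => x; rewrite inE row_ofP nth_word. Qed.

Lemma ex_row (c : 'I_n) : exists r : 'I_(nrows lam), row_of T c = r /\ (c, r) \in T.
Proof.
move: (trT); rewrite inE => /and3P[_ /forallP /(_ c) /cards1P[y ey] _].
have : y \in [set x in T | x.1 == c] by rewrite ey set11.
rewrite inE => /andP[yT /eqP yc]; exists y.2.
by move: (yT); rewrite row_ofP yc => /eqP; rewrite -yc -surjective_pairing.
Qed.

Lemma fills_word : fills heights (word T).
Proof.
apply/and3P; split; first by rewrite size_word.
  rewrite map_inj_in_uniq ?iota_uniq // => i j; rewrite !mem_iota !add0n => /= iN jN.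
  have [r [-> irT]] := ex_row (Ordinal iN); have [r' [-> jrT]] := ex_row (Ordinal jN).
  move=> /val_inj e; rewrite -e in jrT.
  move: (trT); rewrite inE => /and3P[_ _ /forallP /(_ r) /cards1P[y ey]].
  have : (Ordinal iN, r) \in [set x in T | x.2 == r] by rewrite inE irT eqxx.
  have : (Ordinal jN, r) \in [set x in T | x.2 == r] by rewrite inE jrT eqxx.
  by rewrite ey !inE => /eqP <- /eqP[].
apply/(nth_all2_ltn (size_word T)) => i; rewrite size_word size_heights => iN.
rewrite nth_word //; have [r [-> irT]] := ex_row (Ordinal iN).
move: (trT); rewrite inE => /and3P[/subsetP /(_ _ irT)].
by rewrite mem_diagram.
Qed.

Lemma rows_word (r : 'I_(nrows lam)) : val r \in word T.
Proof.
move: (trT); rewrite inE => /and3P[_ _ /forallP /(_ r) /cards1P[y ey]].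
have : y \in [set x in T | x.2 == r] by rewrite ey set11.
rewrite inE row_ofP => /andP[/eqP e /eqP <-]; rewrite /= -e; apply: map_f.
by rewrite mem_iota ltn_ord.
Qed.

End Transversal.

Lemma fills_nth w c : fills heights w -> c < n -> nth 0 w c < nth 0 heights c.
Proof.
by move=> /and3P[/eqP sw _ /(nth_all2_ltn sw) h] cn; apply: h; rewrite sw size_heights.
Qed.

Lemma height_le c : nth 0 heights c <= nrows lam.
Proof.
case: (ltnP c n) => cn; last by rewrite nth_default // size_heights.
by rewrite nth_heights // count_size.
Qed.

Lemma of_word_transversal T w : T \in transversals lam -> fills heights w ->
  perm_eq w (word T) -> of_word w \in transversals lam.
Proof.
move=> trT ww pw; rewrite inE; apply/and3P; split.
- apply/subsetP => x; rewrite inE mem_diagram => /eqP <-.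
  by apply: fills_nth.
- apply/forallP => c; apply/cards1P.
  have rl : nth 0 w c < nrows lam.
    exact: leq_trans (fills_nth ww (ltn_ord c)) (height_le c).
  exists (c, Ordinal rl); apply/setP => x; rewrite !inE -pair_eqE /pair_eq /= andbC.
  by case: (eqVneq x.1 c) => [->|//]; rewrite eq_sym.
- apply/forallP => r; apply/cards1P.
  have rw : val r \in w by rewrite (perm_mem pw) rows_word.
  have /and3P[/eqP sw uw _] := ww.
  have cn : index (val r) w < n by rewrite -size_heights -sw index_mem.
  exists (Ordinal cn, r); apply/setP => x;
    rewrite !inE -pair_eqE /pair_eq /= andbC [RHS]andbC.
  case: (eqVneq x.2 r) => [->|//] /=; apply/eqP/eqP => [e|->]; last by rewrite nth_index.
  by apply: val_inj; rewrite /= -e index_uniq // sw size_heights.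
Qed.

Lemma wordK T w : T \in transversals lam -> fills heights w ->
  perm_eq w (word T) -> word (of_word w) = w.
Proof.
move=> trT ww pw; have tw := of_word_transversal trT ww pw.
have /and3P[/eqP sw _ _] := ww.
apply: (@eq_from_nth _ 0); first by rewrite size_word sw.
move=> i; rewrite size_word size_heights => iN; rewrite nth_word //.
have rl : nth 0 w i < nrows lam := leq_trans (fills_nth ww iN) (height_le i).
by apply/eqP; have := row_ofP tw (Ordinal iN, Ordinal rl); rewrite inE /= eqxx => <-.
Qed.

Lemma contains_occurs m (s : 'S_m) T : T \in transversals lam ->
  contains T s = occurs s heights (word T).
Proof.
move=> trT; have ww := fills_word trT; have /and3P[_ uw _] := ww.
apply/idP/idP.
  move=> /existsP[c /existsP[r /and4P[/forallP hc /forallP hr /forallP hd /forallP hT]]].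
  have cT i : row_of T (c i) = r (s i).
    by have /forallP /(_ (s i)) := hT i; rewrite eqxx eqb_id row_ofP // => /eqP.
  apply/existsP; exists [ffun i => cast_ord (esym size_heights) (c i)].
  apply/copyP; split=> i j; rewrite !ffunE /= ?nth_word ?cT //.
  - by have /forallP /(_ j) /implyP := hc i.
  - by have /forallP /(_ (s i)) := hd j; rewrite mem_diagram.
  - by have /forallP /(_ (s j)) /implyP := hr (s i).
move=> /existsP[d /copyP[h1 h2 h3]].
have d_lt i : d i < n by rewrite -size_heights.
have rl i : nth 0 (word T) (d i) < nrows lam.
  exact: leq_trans (fills_nth ww (d_lt i)) (height_le _).
apply/existsP; exists [ffun i => cast_ord size_heights (d i)].
apply/existsP; exists [ffun j => Ordinal (rl (s^-1 j)%g)].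
apply/and4P; split; apply/forallP => i; apply/forallP => j; rewrite !ffunE /=.
- by apply/implyP; exact: h1.
- by apply/implyP => ij; apply: h3; rewrite !permKV.
- by rewrite mem_diagram /=; exact: h2.
rewrite row_ofP //= -nth_word // nth_uniq ?size_word // -(inj_eq (@perm_inj _ s^-1)%g)
  permK.
apply/eqP; apply/eqP/eqP => [e|->] //.
case: (ltngtP i (s^-1 j)%g) => ij; last exact: val_inj.
  by have := h1 _ _ ij; rewrite e ltnn.
by have := h1 _ _ ij; rewrite e ltnn.
Qed.

Lemma mem_Peak T (i : 'I_n) :
  (i \in Peak T) = (cast_ord (esym size_heights) i \in peaks heights (word T)).
Proof.
rewrite !inE /level /= size_heights -/n.
case: (posnP i) => //= i0; case: (ltnP i.+1 n) => //= it.
have i1 : i.-1 < n by exact: leq_ltn_trans (leq_pred _) (ltn_ord i).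
by rewrite !nth_word ?nth_heights // -!andbA.
Qed.

Lemma Peak_eq T T' : peaks heights (word T) = peaks heights (word T') -> Peak T = Peak T'.
Proof. by move=> e; apply/setP => i; rewrite !mem_Peak e. Qed.

Section Exchange.
Variables (k b : nat) (tau : 'S_b) (r1 r2 : rel nat).
Variables (s1 s2 : 'S_k).
Hypothesis k_gt0 : 0 < k.
Hypothesis (r1_mono : monotone_rel r1) (r2_mono : monotone_rel r2).
Hypothesis occ1 : forall hs t, sorted geq hs ->
  occurs (dsum s1 tau) hs t =
    has_chain r1 k (white_heights tau hs t) (white_word tau hs t).
Hypothesis occ2 : forall hs t, sorted geq hs ->
  occurs (dsum s2 tau) hs t =
    has_chain r2 k (white_heights tau hs t) (white_word tau hs t).

(** Rearrange the white part of T by [transfer]. *)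
Definition exchange (T : {set square lam}) : {set square lam} :=
  let t := word T in
  of_word (replace_white tau heights t
    (transfer r1 r2 k (white_heights tau heights t) (white_word tau heights t))).

Let hs_so := heights_sorted.

Lemma exchange_spec T : T \in avoiders lam (dsum s1 tau) ->
  let t := word T in
  let u := transfer r1 r2 k (white_heights tau heights t) (white_word tau heights t) in
  [/\ T \in transversals lam,
    avoids r1 k (white_heights tau heights t) (white_word tau heights t),
    fills (white_heights tau heights t) u /\ perm_eq u (white_word tau heights t),
    word (exchange T) = replace_white tau heights t u & exchange T \in avoiders lam
      (dsum s2 tau)].
Proof.
rewrite inE => /andP[trT]; rewrite contains_occurs // occ1 // => nt t u.
have wt : fills heights t := fills_word trT.
have at_ : avoids r1 k (white_heights tau heights t) (white_word tau heights t).
  by rewrite /avoids fills_white.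
have [/andP[wu nu] pu _] :=
  transferP (white_heights_sorted tau hs_so t) k_gt0 r1_mono r2_mono at_.
rewrite -/u in wu nu pu.
have ww := fills_replace_white hs_so wt wu pu; have pw := perm_replace_white wt pu.
have e : word (exchange T) = replace_white tau heights t u := wordK trT ww pw.
have trE : exchange T \in transversals lam := of_word_transversal trT ww pw.
split=> //; rewrite inE trE contains_occurs // e occ2 //.
by rewrite white_heights_replace // white_word_replace.
Qed.

Lemma Peak_exchange T : T \in avoiders lam (dsum s1 tau) -> Peak (exchange T) = Peak T.
Proof.
move=> /exchange_spec [trT at_ [wu pu] e _]; apply: Peak_eq; rewrite e.
apply: peaks_replace_white => //; first exact: fills_word.
by have [_ _ ->] := transferP (white_heights_sorted tau hs_so _) k_gt0 r1_mono r2_mono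
  at_.
Qed.

(** The image has the same white squares as T, so its white part and the rest of T can both be
read off. *)
Lemma exchange_inj : {in avoiders lam (dsum s1 tau) &, injective exchange}.
Proof.
move=> T1 T2 /exchange_spec [tr1 a1 [wu1 pu1] e1 _] /exchange_spec [tr2 a2 [wu2 pu2] e2
  _] e.
rewrite e in e1; have er := etrans (esym e1) e2.
have w1 := fills_word tr1; have w2 := fills_word tr2.
have es : white_heights tau heights (word T1) = white_heights tau heights (word T2).
  by rewrite -(white_heights_replace hs_so w1 wu1 pu1) er white_heights_replace.
have eu := white_word_replace hs_so w1 wu1 pu1; rewrite er white_word_replace // in eu.
have ec : white_cols tau heights (word T1) = white_cols tau heights (word T2).
  by rewrite -(white_cols_replace hs_so w1 wu1 pu1) er white_cols_replace.
rewrite -es in eu a2;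
  have et := transfer_inj (white_heights_sorted tau hs_so _) k_gt0 r1_mono r2_mono a2
    a1 eu.
suff ew : word T1 = word T2 by rewrite -(of_wordK tr1) -(of_wordK tr2) ew.
apply: (@eq_from_nth _ 0) => [|c]; first by rewrite !size_word.
rewrite size_word => cN.
have := mem_white_cols tau heights (word T1) c; rewrite ec mem_white_cols cN !andbT => wc.
case: (boolP (white_col tau heights (word T1) c)) => c1; last first.
  have := congr1 (fun s => nth 0 s c) er; rewrite /= !nth_replace_white //.
  by rewrite wc (negPf c1).
have cw : c \in white_cols tau heights (word T1) by rewrite mem_white_cols c1.
have := congr1 (fun s => nth 0 s (index c (white_cols tau heights (word T1)))) et.
have nm (t : seq nat) (cs : seq nat) : c \in cs ->
  nth 0 [seq nth 0 t j | j <- cs] (index c cs) = nth 0 t c.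
  by move=> cc; rewrite (nth_map 0) ?index_mem // nth_index.
by rewrite /= /white_word -ec !nm.
Qed.

Lemma card_exchange : #|avoiders lam (dsum s1 tau)| <= #|avoiders lam (dsum s2 tau)|.
Proof.
rewrite -(card_in_imset exchange_inj);
  apply/subset_leq_card/subsetP => _ /imsetP[T aT ->].
by have [] := exchange_spec aT.
Qed.

End Exchange.
End Diagram.

Theorem theorem1p3 (k : nat) (hk : 1 <= k) (lam : seq nat)
  (hlam : is_partition lam) (b : nat) (tau : 'S_b) :
  (\sum_(T in avoiders lam (dsum (perm_I k) tau))
      \prod_(i in Peak T) 'X_i)%R
  = (\sum_(T in avoiders lam (dsum (perm_J k) tau))
      \prod_(i in Peak T) 'X_i)%R :> {mpoly int[ncols lam]}.
Proof.
have oI hs t (so : sorted geq hs) := @occurs_I k b tau hs t so hk.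
have oJ hs t (so : sorted geq hs) := @occurs_J k b tau hs t so hk.
have mI : monotone_rel ltn by left.
have mJ : monotone_rel gtn by right.
have inj := exchange_inj hlam hk mI mJ oI oJ.
have cJI := card_exchange hlam hk mJ mI oJ oI.
set A := avoiders lam (dsum (perm_I k) tau) in inj cJI *.
set B := avoiders lam (dsum (perm_J k) tau) in cJI *.
have imB : [set exchange k tau ltn gtn T | T in A] = B.
  apply/eqP; rewrite eqEcard (card_in_imset inj) cJI andbT.
  apply/subsetP => _ /imsetP[T AT ->].
  by have [] := exchange_spec hlam hk mI mJ oI oJ AT.
rewrite -imB big_imset //=; apply: eq_bigr => T AT.
by rewrite (Peak_exchange hlam hk mI mJ oI oJ).
Qed.
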